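(* Let $K\subseteq\mathbb{R}^n$ be closed and convex, equipped with its subspace Sikorski structure $\mathcal{F}_K$ induced from $\mathbb{R}^n$. Then $\mathcal{F}_K$ is reflexive, i.e. $\Phi\Pi\mathcal{F}_K=\mathcal{F}_K$.
   Context: ''Smooth'' means $C^\infty$. A cartesian space is $\mathbb{R}^d$ for some $d\in\mathbb{N}$, with its standard smooth structure. Sikorski structures. A Sikorski structure on a set $X$ is a non-empty collection $\mathcal{F}_X$ of real-valued functions on $X$ such that, with $X$ equipped with the initial topology (the weakest topology making all functions in $\mathcal{F}_X$ continuous): (S1) if $f_1,\ldots,f_n\in\mathcal{F}_X$ and $g\in C^\infty(\mathbb{R}^n)$, then $g\circ(f_1,\ldots,f_n)\in\mathcal{F}_X$; (S2) given $f\colon X\to\mathbb{R}$, if for each point of $X$ there exist a neighbourhood $V$ and $g\in\mathcal{F}_X$ with $g|_V=f|_V$, then $f\in\mathcal{F}_X$. A map between Sikorski spaces $(X,\mathcal{F}_X)\to(Y,\mathcal{F}_Y)$ is Sikorski smooth if its composition with every function in $\mathcal{F}_Y$ is in $\mathcal{F}_X$. A manifold (in particular an open subset of a cartesian space) carries the Sikorski structure of all $C^\infty$ real-valued functions. For a subset $V$ of a Sikorski space $(X,\mathcal{F}_X)$, the subspace Sikorski structure is the set of functions $f\colon V\to\mathbb{R}$ such that each point of $V$ has a neighbourhood $W$ in $X$ and a function $g\in\mathcal{F}_X$ with $g|_{V\cap W}=f|_{V\cap W}$. Diffeologies. A diffeology on a set $X$ is a collection $\mathcal{D}_X$ of maps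 (plots) from open subsets of cartesian spaces to $X$ such that: (D1) constant maps are plots; (D2) precompositions of plots with $C^\infty$ maps between open subsets of cartesian spaces are plots; (D3) $p\colon U\to X$ is a plot if each point of $U$ has a neighbourhood $V$ with $p|_V$ a plot. A map between diffeological spaces is diffeologically smooth if its precomposition with every plot of the source is a plot of the target; a manifold carries the diffeology of all $C^\infty$ maps from open subsets of cartesian spaces. For a Sikorski structure $\mathcal{F}_X$, $\Pi\mathcal{F}_X$ denotes the diffeology of all Sikorski smooth maps from open subsets of cartesian spaces to $X$. For a diffeology $\mathcal{D}_X$, $\Phi\mathcal{D}_X$ denotes the Sikorski structure of all diffeologically smooth real-valued functions on $X$. A Sikorski structure $\mathcal{F}_X$ is reflexive if $\Phi\Pi\mathcal{F}_X=\mathcal{F}_X$. *)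

(* Defs.v *)
From HB Require Import structures.
From mathcomp Require Import all_boot all_order all_algebra.
From mathcomp Require Import all_classical all_reals all_analysis.
Set Implicit Arguments.
Unset Strict Implicit.
Unset Printing Implicit Defensive.
Import Order.TTheory GRing.Theory Num.Theory.
Import numFieldNormedType.Exports.
Local Open Scope classical_set_scope.
Local Open Scope ring_scope.

Section smooth_on.
Context {R : realType}.
Implicit Types (V W : normedModType R).

(* Intended for open [U]: [f] is C^(k+1) on [U] when it is Frechet
   differentiable there and all its directional derivatives are C^k on [U]. *)
Fixpoint Ck_on {V W} (k : nat) (U : set V) (f : V -> W) : Prop :=
  match k with
  | 0 => forall x, U x -> {for x, continuous f}
  | k'.+1 => (forall x, U x -> differentiable f x) /\
             (forall v : V, Ck_on k' U ('D_v f))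
  end.

Definition smooth_on {V W} (U : set V) (f : V -> W) : Prop :=
  forall k, Ck_on k U f.

Lemma differentiable_of V W (f : V -> W) (df : {linear V -> W}) x :
  continuous df -> f \o shift x = cst (f x) + df +o_ 0 id ->
  differentiable f x.
Proof.
move=> cdf fE; apply/diff_locallyP; rewrite (diff_unique cdf fE).
by split=> //; exact: fE.
Qed.

Lemma near_eq_differentiable V W (f g : V -> W) x :
  (\near x, f x = g x) -> differentiable f x -> differentiable g x.
Proof.
move=> fg /[dup] df /diff_locallyP[cdf fE].
apply: (@differentiable_of _ _ _ ('d f x)) => //.
rewrite -(nbhs_singleton fg).
apply/eqaddoP => e e0; have {fE} := (iffLR (eqaddoP _ _ _ _) fE) _ e0.
have fg0 : \forall h \near (0 : V), f (h + x) = g (h + x).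
  by move: fg; rewrite (near_shift 0 x) subr0.
apply: filter_app; near=> h.
by rewrite !fctE /= (near fg0 h) //.
Unshelve. all: by end_near. Qed.

Lemma Ck_onS V W k (U : set V) (f : V -> W) : Ck_on k.+1 U f -> Ck_on k U f.
Proof.
elim: k f => [|k IH] f /=.
  by move=> [df _] x Ux; apply: differentiable_continuous; exact: df.
by move=> [df dDf]; split=> // v; apply: IH; split=> [x Ux|w];
  have [] := dDf v; [move=> h _; exact: h|move=> _; exact].
Qed.

Lemma Ck_on_near V W k (U : set V) (f : V -> W) :
  (forall x, U x -> exists A (g : V -> W),
     [/\ open A, A x, {in A, f =1 g} & Ck_on k A g]) -> Ck_on k U f.
Proof.
elim: k U f => [|k IH] U f fg /=.
  move=> x /fg[A [g [oA Ax fgE cg]]].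
  have fgx : {near x, f =1 g}.
    by near=> y; apply: fgE; rewrite inE; near: y; exact: open_nbhs_nbhs.
  rewrite /prop_for /continuous_at (nbhs_singleton fgx).
  apply: cvg_trans (cg _ Ax); apply: near_eq_cvg.
  by move: fgx; apply: filterS => y ->.
have eqn x A g : open A -> A x -> {in A, f =1 g} -> {near x, f =1 g}.
  move=> oA Ax fgE; near=> y; apply: fgE; rewrite inE; near: y.
  exact: open_nbhs_nbhs.
split=> [x /fg[A [g [oA Ax fgE [dg _]]]]|v].
  apply: (near_eq_differentiable _ (dg _ Ax)).
  by move: (eqn _ _ _ oA Ax fgE); apply: filterS => y ->.
apply: IH => x /fg[A [g [oA Ax fgE [_ dg]]]].
exists A, ('D_v g); split => //; last exact: dg.
move=> y; rewrite inE => Ay.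
by apply: near_eq_derive; exact: (eqn _ _ _ oA Ay fgE).
Unshelve. all: by end_near. Qed.

Lemma Ck_on_eq V W k (U : set V) (f g : V -> W) :
  open U -> {in U, f =1 g} -> Ck_on k U g -> Ck_on k U f.
Proof. by move=> oU fg cg; apply: Ck_on_near => x Ux; exists U, g. Qed.

Lemma Ck_on_sub V W k (U U' : set V) (f : V -> W) :
  U' `<=` U -> Ck_on k U f -> Ck_on k U' f.
Proof.
move=> U'U; elim: k f => [|k IH] f /=; first by move=> cf x /U'U; exact: cf.
by move=> [df dDf]; split=> [x /U'U|v]; [exact: df|exact/IH/dDf].
Qed.

Lemma Ck_on_cst V W k (U : set V) (a : W) : Ck_on k U (cst a).
Proof.
elim: k a => [|k IH] a /=; first by move=> x _; exact: cst_continuous.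
split=> [x _|v]; first exact: differentiable_cst.
have -> : 'D_v (cst a : V -> W) = cst 0 by apply/funext => x; exact: derive_cst.
exact: IH.
Qed.

Lemma Ck_onD V W k (U : set V) (f g : V -> W) : open U ->
  Ck_on k U f -> Ck_on k U g -> Ck_on k U (f + g).
Proof.
move=> oU; elim: k f g => [|k IH] f g /=.
  by move=> cf cg x Ux; apply: continuousD; [exact: cf|exact: cg].
move=> [df dDf] [dg dDg]; split=> [x Ux|v].
  by apply: differentiableD; [exact: df|exact: dg].
apply: (@Ck_on_eq _ _ _ _ _ ('D_v f + 'D_v g)) => //; last exact: IH.
move=> x; rewrite inE => Ux; rewrite deriveD//; apply: diff_derivable; [exact: df|exact: dg].
Qed.

Lemma Ck_on_sum V W k (U : set V) n (f : 'I_n -> V -> W) : open U ->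
  (forall i, Ck_on k U (f i)) -> Ck_on k U (\sum_(i < n) f i).
Proof.
move=> oU cf; elim/big_ind : _ => //; first exact: (@Ck_on_cst _ _ _ _ 0).
by move=> *; exact: Ck_onD.
Qed.

Lemma Ck_onM V k (U : set V) (f g : V -> R) : open U ->
  Ck_on k U f -> Ck_on k U g -> Ck_on k U (f * g).
Proof.
move=> oU; elim: k f g => [|k IH] f g.
  by move=> cf cg x Ux; apply: continuousM; [exact: cf|exact: cg].
move=> /[dup] /Ck_onS cf [df dDf] /[dup] /Ck_onS cg [dg dDg].
split=> [x Ux|v].
  by apply: differentiableM; [exact: df|exact: dg].
apply: (@Ck_on_eq _ _ _ _ _ (f * 'D_v g + g * 'D_v f)) => //.
  by move=> x; rewrite inE => Ux; rewrite deriveM//; apply: diff_derivable;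
    [exact: df|exact: dg].
by apply: Ck_onD => //; apply: IH => //; [exact: dDg|exact: dDf].
Qed.

Lemma continuous_row V m (g : 'I_m -> V -> R) x :
  (forall i, {for x, continuous (g i)}) ->
  {for x, continuous (fun x => \row_i g i x)}.
Proof.
move=> cg; apply/cvgrPdist_lt => e e0; near=> y.
rewrite /Num.Def.normr/= mx_normrE; apply: bigmax_lt => //= i _.
rewrite !mxE; move: i => [? i]; rewrite /=; move: i; near: y.
apply: filter_forall => i; exact: (cvgrPdist_lt _ _).1 (cg i) _ e0.
Unshelve. all: by end_near. Qed.

Lemma differentiable_row V m (g : 'I_m -> V -> R) x :
  (forall i, differentiable (g i) x) ->
  differentiable (fun x => \row_i g i x) x.
Proof.
move=> dg.
have -> : (fun x => \row_i g i x) =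
    \sum_(i < m) (fun x => g i x *: delta_mx 0 i : 'rV[R]_m).
  apply/funext => y; rewrite fct_sumE [LHS]row_sum_delta.
  by apply: eq_bigr => i _; rewrite mxE.
by apply: differentiable_sum => i; exact: differentiableZl.
Qed.

Lemma Ck_on_comp_row V m k (U : set V) (U' : set 'rV[R]_m) (f : 'rV[R]_m -> R)
    (g : 'I_m -> V -> R) : open U -> (forall x, U x -> U' (\row_i g i x)) ->
  Ck_on k U' f -> (forall i, Ck_on k U (g i)) ->
  Ck_on k U (fun x => f (\row_i g i x)).
Proof.
move=> oU gU; elim: k f g gU => [|k IH] f g gU.
  move=> cf cg x Ux; apply: (@continuous_comp _ _ _ (fun x => \row_i g i x) f).
    by apply: continuous_row => i; exact: cg.
  exact/cf/gU.
move=> [df dDf] cg.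
have dG x : U x -> differentiable (fun x => \row_i g i x) x.
  by move=> Ux; apply: differentiable_row => i; have [+ _] := cg i; exact.
split=> [x Ux|v].
  exact: (@differentiable_comp _ _ _ _ (fun x => \row_i g i x) f _ (dG _ Ux) (df _ (gU _ Ux))).
apply: (@Ck_on_eq _ _ _ _ _ (\sum_(j < m) ('D_v (g j) *
    (fun x => 'D_(delta_mx 0 j) f (\row_i g i x))))) => //.
  move=> x; rewrite inE => Ux.
  have dGx := dG _ Ux; have dfx := df _ (gU _ Ux).
  rewrite deriveE; last first.
    exact: (@differentiable_comp _ _ _ _ (fun x => \row_i g i x) f).
  rewrite (@diff_comp _ _ _ _ (fun x => \row_i g i x) f) //=.
  rewrite -(deriveE v dGx) derive_mx; last exact/diff_derivable.
  rewrite [X in 'd f _ X]row_sum_delta linear_sum fct_sumE.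
  apply: eq_bigr => j _; rewrite linearZ /= fctE mxE.
  rewrite -[X in _ *: X](deriveE _ dfx); congr (_ *: _); congr (derive _ _ _).
  by apply/funext => y; rewrite mxE.
apply: Ck_on_sum => // j; apply: Ck_onM => //; first by have [_] := cg j; exact.
apply: (IH ('D_(delta_mx 0 j) f) g gU); first exact: dDf.
by move=> i; exact: Ck_onS.
Qed.

Lemma Ck_on_coord V m k (U : set V) (h : V -> 'rV[R]_m) i : open U ->
  Ck_on k U h -> Ck_on k U (fun x => h x 0 i).
Proof.
move=> oU; elim: k h => [|k IH] h.
  move=> ch x Ux; apply: (@continuous_comp _ _ _ h (fun M => M 0 i)).
    exact: ch.
  exact: coord_continuous.
move=> [dh dDh]; split=> [x Ux|v].
  apply: (@differentiable_comp _ _ _ _ h (fun M => M 0 i : R)); first exact: dh.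
  exact: differentiable_coord.
apply: (@Ck_on_eq _ _ _ _ _ (fun x => 'D_v h x 0 i)) => //; last first.
  exact/IH/dDh.
move=> x; rewrite inE => Ux.
by rewrite derive_mx ?mxE//; exact/diff_derivable/dh.
Qed.

End smooth_on.

Record opens (R : realType) (d : nat) := Opens {
  opens_set :> set 'rV[R]_d ;
  opens_open : open opens_set }.

(* [f] is extended by 0 outside [U]; as [U] is open, the derivatives of the
   extension at points of [U] only depend on [f]. *)
Definition smooth_fun (R : realType) (d : nat) (U : opens R d)
    (W : normedModType R) (f : U -> W) : Prop :=
  smooth_on U ('valL_0 f).

Definition smooth_map (R : realType) (d e : nat) (U : opens R d)
    (V : opens R e) (h : U -> V) : Prop :=
  smooth_fun (set_val \o h).

Section smooth_fun.
Context {R : realType}.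

Lemma valL_val (T W : Type) (A : set T) (w : W) (f : A -> W) (x : A) :
  ('valL_w f) (set_val x) = f x.
Proof. exact: (congr1 (fun h => h x) (@valLK _ _ w A f)). Qed.

Lemma set_val_inj (T : Type) (A : set T) : injective (@set_val T A).
Proof. by move=> [x xA] [y yA] xy; apply: val_inj; exact: xy. Qed.

Lemma set_val_ex (T : Type) (A : set T) (x : T) : A x ->
  exists a : A, x = set_val a.
Proof. by move=> Ax; exists (SigSub (mem_set Ax)). Qed.

Lemma set_valE_in (T : Type) (A : set T) (a : A) : A (set_val a).
Proof. by case: a => x xA; exact: set_mem. Qed.

Lemma smooth_fun_near d (U : opens R d) (W : normedModType R) (f : U -> W) :
  (forall x : U, exists (V : set 'rV[R]_d) (g : 'rV[R]_d -> W),
     [/\ open V, V (set_val x), forall y : U, V (set_val y) -> f y = g (set_val y)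
       & smooth_on (V `&` U) g]) -> smooth_fun f.
Proof.
move=> fg k; apply: Ck_on_near => x0 Ux0; have [x ->] := set_val_ex Ux0.
have [V [g [oV Vx fgE sg]]] := fg x.
exists (V `&` U), g; split=> //.
- by apply: openI => //; exact: opens_open.
- by split=> //; exact: set_valE_in.
- move=> y; rewrite inE => -[Vy Uy].
  by have [z yz] := set_val_ex Uy; rewrite yz valL_val fgE// -yz.
Qed.

Lemma smooth_fun_eq d (U : opens R d) (W : normedModType R) (f : U -> W) g :
  smooth_on U g -> (forall y : U, f y = g (set_val y)) -> smooth_fun f.
Proof.
move=> sg fgE; apply: smooth_fun_near => x; exists U, g; split=> //.
- exact: opens_open.
- exact: set_valE_in.
- by rewrite setIid.
Qed.

Lemma smooth_fun_cst d (U : opens R d) (W : normedModType R) (a : W) :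
  smooth_fun (fun _ : U => a).
Proof. by apply: (@smooth_fun_eq _ _ _ _ (cst a)) => // k; exact: Ck_on_cst. Qed.

Lemma smooth_fun_continuous d (U : opens R d) (W : normedModType R) (f : U -> W) :
  smooth_fun f -> continuous f.
Proof.
move=> sf x.
have -> : f = ('valL_0 f) \o set_val by apply/funext => y; exact/esym/valL_val.
apply: continuous_comp; first exact: initial_continuous.
exact: (sf 0 _ (set_valE_in x)).
Qed.

Lemma smooth_fun_comp_row d (U : opens R d) m (f : 'I_m -> U -> R)
    (g : 'rV[R]_m -> R) :
  (forall i, smooth_fun (f i)) -> smooth_on setT g ->
  smooth_fun (fun x => g (\row_i f i x)).
Proof.
move=> sf sg.
apply: (@smooth_fun_eq _ _ _ _ (fun x => g (\row_i ('valL_0 (f i)) x))).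
  move=> k; apply: (@Ck_on_comp_row _ _ _ _ _ setT _ (fun i => 'valL_0 (f i))) => //.
  - exact: opens_open.
  - by move=> i; exact: sf.
move=> y; congr g; apply/rowP => i; rewrite !mxE.
by rewrite -[RHS]/(('valL_0 (f i)) (set_val y)) valL_val.
Qed.

Lemma smooth_fun_comp d e (U : opens R d) (V : opens R e) (h : U -> V)
    (f : V -> R) : smooth_map h -> smooth_fun f -> smooth_fun (f \o h).
Proof.
move=> sh sf.
pose H := 'valL_0 (set_val \o h) : 'rV[R]_d -> 'rV[R]_e.
have HE (y : U) : H (set_val y) = set_val (h y) by rewrite /H valL_val.
have rE x : \row_i H x 0 i = H x by apply/rowP => i; rewrite mxE.
apply: (@smooth_fun_eq _ _ _ _ (fun x => ('valL_0 f) (\row_i (H x 0 i)))).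
  move=> k; apply: (@Ck_on_comp_row _ _ _ _ _ V _ (fun i x => H x 0 i)) => //.
  - exact: opens_open.
  - by move=> y Uy; have [x ->] := set_val_ex Uy; rewrite rE HE; exact: set_valE_in.
  - by move=> i; apply: Ck_on_coord; [exact: opens_open|exact: sh].
by move=> y; rewrite rE HE valL_val.
Qed.

End smooth_fun.

Definition sikorski_topology (R : realType) (X : choiceType)
    (F : set (X -> R)) : Type :=
  sup_topology (fun f : F => Topological.on (initial_topology (set_val f))).

HB.instance Definition _ (R : realType) (X : choiceType) (F : set (X -> R)) :=
  Topological.copy (sikorski_topology F)
    (sup_topology (fun f : F => Topological.on (initial_topology (set_val f)))).

Record sikorski (R : realType) (X : choiceType) := Sikorski {
  sikorski_fun :> set (X -> R) ;
  sikorski_nonempty : sikorski_fun !=set0 ;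
  sikorski_comp : forall n (f : 'I_n -> X -> R) (g : 'rV[R]_n -> R),
    (forall i, sikorski_fun (f i)) -> smooth_on setT g ->
    sikorski_fun (fun x => g (\row_i f i x)) ;
  sikorski_local : forall f : X -> R,
    (forall x, exists (V : set X) (g : X -> R),
       [/\ nbhs (x : sikorski_topology sikorski_fun) V, sikorski_fun g
         & {in V, g =1 f}]) ->
    sikorski_fun f }.

Definition sikorski_smooth (R : realType) (X Y : choiceType)
    (FX : sikorski R X) (FY : sikorski R Y) (h : X -> Y) : Prop :=
  forall g, sikorski_fun FY g -> sikorski_fun FX (g \o h).

Definition incl_set (T : Type) (A B : set T) (AB : A `<=` B) (x : A) : B :=
  SigSub (mem_set (AB _ (set_valP x))).

Record diffeology (R : realType) (X : Type) := Diffeology {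
  plot :> forall d (U : opens R d), (U -> X) -> Prop ;
  plot_cst : forall d (U : opens R d) (c : X), plot (fun _ : U => c) ;
  plot_comp : forall d e (U : opens R d) (V : opens R e) (h : U -> V)
    (p : V -> X), smooth_map h -> plot p -> plot (p \o h) ;
  plot_local : forall d (U : opens R d) (p : U -> X),
    (forall x : U, exists (V : opens R d) (VU : V `<=` U),
       opens_set V (set_val x) /\ plot (p \o incl_set VU)) ->
    plot p }.

Definition diffeo_smooth (R : realType) (X Y : Type) (DX : diffeology R X)
    (DY : diffeology R Y) (h : X -> Y) : Prop :=
  forall d (U : opens R d) (p : U -> X), DX d U p -> DY d U (h \o p).

Section structures.
Context {R : realType}.

Lemma sikorski_continuous (X : choiceType) (F : set (X -> R)) f :
  F f -> continuous (f : sikorski_topology F -> R).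
Proof.
move=> Ff x A fA.
pose i : F := SigSub (mem_set Ff).
have := (@cvg_sup X F
  (fun f : F => Topological.on (initial_topology (set_val f)))
  (nbhs (x : sikorski_topology F)) x _).1 (fun _ h => h) i.
apply; exact: (@initial_continuous _ _ f x A fA).
Qed.

Lemma continuous_sikorski (T : topologicalType) (X : choiceType)
    (F : set (X -> R)) (h : T -> X) :
  (forall f, F f -> continuous (f \o h)) ->
  continuous (h : T -> sikorski_topology F).
Proof.
move=> ch x; apply/(@cvg_sup X F
  (fun f : F => Topological.on (initial_topology (set_val f)))) => i A.
move=> [_ [[B oB <-] /= Bx BA]].
have : nbhs x ((set_val i \o h) @^-1` B).
  by apply: (ch (set_val i) (set_valE_in i) x); exact: open_nbhs_nbhs.
by apply: filterS => y; exact: BA.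
Qed.

Section euclidean.
Context (n : nat).
Let F : set ('rV[R]_n -> R) := [set f | smooth_on setT f].

Let F_nonempty : F !=set0.
Proof. by exists (cst 0) => k; exact: Ck_on_cst. Qed.

Let F_comp m (f : 'I_m -> 'rV[R]_n -> R) (g : 'rV[R]_m -> R) :
  (forall i, F (f i)) -> smooth_on setT g -> F (fun x => g (\row_i f i x)).
Proof.
move=> sf sg k; apply: (@Ck_on_comp_row _ _ _ _ _ setT) => //; first exact: openT.
by move=> i; exact: sf.
Qed.

Let F_local (f : 'rV[R]_n -> R) :
  (forall x, exists (V : set 'rV[R]_n) (g : 'rV[R]_n -> R),
     [/\ nbhs (x : sikorski_topology F) V, F g & {in V, g =1 f}]) -> F f.
Proof.
move=> fg k; apply: Ck_on_near => x _; have [V [g [xV Fg gf]]] := fg x.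
have : nbhs x V.
  apply: (@continuous_sikorski _ _ F id _ x V xV) => h sh y.
  exact: (sh 0).
rewrite nbhsE => -[A [oA Ax] AV]; exists A, g; split=> //.
  by move=> y; rewrite inE => /AV Vy; rewrite gf// inE.
exact: Ck_on_sub (Fg k).
Qed.

Definition euclidean_sikorski : sikorski R 'rV[R]_n :=
  Sikorski F_nonempty F_comp F_local.

End euclidean.

Section opens_sikorski.
Context (d : nat) (U : opens R d).
Let F : set (U -> R) := [set f | smooth_fun f].

Let F_nonempty : F !=set0.
Proof. by exists (cst 0); exact: smooth_fun_cst. Qed.

Let F_local (f : U -> R) :
  (forall x, exists (V : set U) (g : U -> R),
     [/\ nbhs (x : sikorski_topology F) V, F g & {in V, g =1 f}]) -> F f.
Proof.
move=> fg; apply: smooth_fun_near => x; have [V [g [xV Fg gf]]] := fg x.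
have : nbhs x V.
  apply: (@continuous_sikorski _ _ F id _ x V xV) => h sh.
  exact: smooth_fun_continuous.
move=> [_ [[A oA <-] /= Ax AV]]; exists A, ('valL_0 g); split=> //.
  by move=> y Ay; rewrite valL_val gf// inE; exact: AV.
by move=> k; exact: Ck_on_sub (Fg k).
Qed.

Definition opens_sikorski : sikorski R U :=
  Sikorski F_nonempty (@smooth_fun_comp_row _ _ U) F_local.

End opens_sikorski.

Section subspace_sikorski.
Context (X : choiceType) (FX : sikorski R X) (A : set X).
Let F : set (A -> R) := [set f | forall a : A, exists (W : set X) (g : X -> R),
  [/\ nbhs (set_val a : sikorski_topology FX) W, sikorski_fun FX g
    & forall y : A, W (set_val y) -> g (set_val y) = f y]].

Let F_nonempty : F !=set0.
Proof.
have [g Fg] := sikorski_nonempty FX.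
exists (g \o set_val) => a; exists setT, g; split=> //; exact: filterT.
Qed.

Let F_comp n (f : 'I_n -> A -> R) (g : 'rV[R]_n -> R) :
  (forall i, F (f i)) -> smooth_on setT g -> F (fun x => g (\row_i f i x)).
Proof.
move=> Ff sg a.
have /choice[W /choice[h hP]] := fun i => Ff i a.
exists [set x | forall i, W i x], (fun x => g (\row_i h i x)); split.
- apply: (@filter_forall (sikorski_topology FX) _ W
    (nbhs (set_val a : sikorski_topology FX))) => i.
  by have [] := hP i.
- by apply: sikorski_comp => // i; have [] := hP i.
- move=> y Wy; congr g; apply/rowP => i; rewrite !mxE.
  by have [_ _ ->] := hP i.
Qed.

Let F_local (f : A -> R) :
  (forall x, exists (V : set A) (g : A -> R),
     [/\ nbhs (x : sikorski_topology F) V, F g & {in V, g =1 f}]) -> F f.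
Proof.
move=> fg a; have [V [g [aV Fg gf]]] := fg a.
pose T := initial_topology (set_val : A -> sikorski_topology FX).
have : nbhs (a : T) V.
  apply: (@continuous_sikorski T _ F id _ a V aV) => h Fh y B hB.
  have [W [k [yW Fk kh]]] := Fh y.
  have cv : {for y, continuous (set_val : T -> sikorski_topology FX)}.
    exact: initial_continuous.
  have yW' : nbhs y [set z : T | W (set_val z)] := cv _ yW.
  have kB : nbhs (set_val y : sikorski_topology FX) (k @^-1` B).
    apply: (sikorski_continuous Fk); rewrite /= kh//.
    exact: nbhs_singleton yW.
  have kB' : nbhs y [set z : T | B (k (set_val z))] := cv _ kB.
  by apply: filterS2 yW' kB' => z Wz Bz; rewrite /= -kh.
move=> [_ [[B oB <-] /= Ba BV]].
have [W [h [aW Fh hg]]] := Fg a.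
exists (B `&` W), h; split=> //.
  by apply: filterI => //; exact: open_nbhs_nbhs.
by move=> y [By Wy]; rewrite hg// gf// inE; exact: BV.
Qed.

Definition subspace_sikorski : sikorski R A :=
  Sikorski F_nonempty F_comp F_local.

End subspace_sikorski.

Section real_diffeology.

Let P d (U : opens R d) (p : U -> R) := smooth_fun p.

Let P_local d (U : opens R d) (p : U -> R) :
  (forall x : U, exists (V : opens R d) (VU : V `<=` U),
     opens_set V (set_val x) /\ P (p \o incl_set VU)) -> P p.
Proof.
move=> ph; apply: smooth_fun_near => x; have [V [VU [Vx sp]]] := ph x.
exists V, ('valL_0 (p \o incl_set VU)); split=> //.
- exact: opens_open.
- move=> y Vy; have [z yz] := set_val_ex Vy; rewrite yz valL_val; congr p.
  exact: set_val_inj.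
- by move=> k; exact: Ck_on_sub (sp k).
Qed.

Definition real_diffeology : diffeology R R :=
  @Diffeology _ _ P (fun d U c => smooth_fun_cst U c)
    (fun d e U V h p => @smooth_fun_comp _ d e U V h p) P_local.

End real_diffeology.

Section Pi_diffeology.
Context (X : choiceType) (F : sikorski R X).

Let P d (U : opens R d) (p : U -> X) := sikorski_smooth (opens_sikorski U) F p.

Let P_cst d (U : opens R d) (c : X) : P (fun _ : U => c).
Proof. by move=> g _; exact: smooth_fun_cst. Qed.

Let P_comp d e (U : opens R d) (V : opens R e) (h : U -> V) (p : V -> X) :
  smooth_map h -> P p -> P (p \o h).
Proof. by move=> sh Pp g /Pp; exact: smooth_fun_comp. Qed.

Let P_local d (U : opens R d) (p : U -> X) :
  (forall x : U, exists (V : opens R d) (VU : V `<=` U),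
     opens_set V (set_val x) /\ P (p \o incl_set VU)) -> P p.
Proof.
move=> ph g Fg; apply: (@plot_local R R real_diffeology d U (g \o p)) => x.
by have [V [VU [Vx sp]]] := ph x; exists V, VU; split=> //; exact: sp.
Qed.

Definition Pi_diffeology : diffeology R X := Diffeology P_cst P_comp P_local.

End Pi_diffeology.

Section Phi_sikorski.
Context (X : choiceType) (D : diffeology R X).

Let F : set (X -> R) := [set f | diffeo_smooth D real_diffeology f].

Let F_nonempty : F !=set0.
Proof. by exists (cst 0) => d U p _; exact: smooth_fun_cst. Qed.

Let F_comp n (f : 'I_n -> X -> R) (g : 'rV[R]_n -> R) :
  (forall i, F (f i)) -> smooth_on setT g -> F (fun x => g (\row_i f i x)).
Proof.
move=> Ff sg d U p Dp.
apply: (@smooth_fun_comp_row _ _ U _ (fun i => f i \o p)) => // i.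
exact: Ff.
Qed.

Let F_local (f : X -> R) :
  (forall x, exists (V : set X) (g : X -> R),
     [/\ nbhs (x : sikorski_topology F) V, F g & {in V, g =1 f}]) -> F f.
Proof.
move=> fg d U p Dp; apply: smooth_fun_near => x.
have [V [g [xV Fg gf]]] := fg (p x).
have : nbhs x (p @^-1` V).
  apply: (@continuous_sikorski _ _ F p _ x V xV) => h Fh.
  exact/smooth_fun_continuous/Fh.
move=> [_ [[A oA <-] /= Ax AV]]; exists A, ('valL_0 (g \o p)); split=> //.
  by move=> y Ay; rewrite valL_val -[RHS]/(g (p y)) gf// inE; exact: AV.
by move=> k; exact: Ck_on_sub (Fg _ _ _ Dp k).
Qed.

Definition Phi_sikorski : sikorski R X :=
  Sikorski F_nonempty F_comp F_local.

End Phi_sikorski.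

End structures.

Definition reflexive_sikorski (R : realType) (X : choiceType)
    (F : sikorski R X) : Prop :=
  Phi_sikorski (Pi_diffeology F) = F.

Lemma eq_sikorski (R : realType) (X : choiceType) (F G : sikorski R X) :
  (F = G :> set (X -> R)) -> F = G.
Proof.
case: F => F F1 F2 F3; case: G => G G1 G2 G3 /= FG; case: _ / FG in G1 G2 G3 *.
by congr Sikorski; exact: Prop_irrelevance.
Qed.

(* Main.v *)
Require Import Defs.
From mathcomp Require Import all_boot all_order all_algebra.
From mathcomp Require Import all_classical all_reals all_analysis.
From mathcomp Require Import ring lra zify.
Set Implicit Arguments.
Unset Strict Implicit.
Unset Printing Implicit Defensive.
Import Order.TTheory GRing.Theory Num.Theory.
Import numFieldNormedType.Exports.
Local Open Scope classical_set_scope.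
Local Open Scope ring_scope.

(** A function on K that locally extends to a smooth function on R^n is smooth
    along every plot, so one inclusion is formal.  For the other, let f be
    smooth along every smooth map into K.  Extending f near a point concerns
    only the intersection of K with a closed ball, so K may be taken compact;
    a maximal affinely independent family in K ([affine_frame]) gives affine
    coordinates in which K contains a ball ([simplex_ball]).

    Derivatives up to the boundary.  For c and y in K the curve
    s |-> y + s^2 (c - y) stays in K for |s| <= 1, so half the second
    derivative at 0 of f along it makes sense at every point y of K.  Since a
    plot may be given one more parameter s, this function of y is again smooth
    along plots ([plot_smooth_curve_derive]); in the interior it is the
    derivative of f at y in direction c - y.  Subtracting two of them gives
    the partial derivatives ([plot_smooth_partial]).  A function smooth along
    plots is bounded on a compact convex set ([plot_smooth_bounded]): if it
    were not, a smooth curve in K through rapidly converging points at which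
    it is large would contradict continuity.  By induction all derivatives of
    f are bounded on the interior of K ([plot_smooth_dbound]).

    Extension.  Let b be interior to K, let (S_k g)(x) = g(b + q_k (x - b))
    with q_k = 1 - 2^-k, and put R_0 = f, R_(k+1) = R_k - S_(k+1) R_k.  Then
    f = sum_k S_(k+1) R_k in the interior of K, and each term is defined and
    smooth on a neighbourhood of K whose width is of order 2^-k.  The operator
    1 - S_k at most doubles bounds on derivatives, and gains a factor
    proportional to 2^-k at the cost of one more derivative.  Using the second
    fact m times and the first fact otherwise, the derivatives of R_k are
    O(2^k 2^-(mk)) for every m ([remainder_bound]), hence small compared with
    every power of 2^-k.  A cutoff that is 1 on K and vanishes outside the
    neighbourhood costs a power of 2^k that depends only on the order of
    differentiation ([dbound_cutoff]), so the sum of the cut-off terms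
    converges with all derivatives to a smooth function on R^n
    ([smooth_sum_series]) which equals f in the interior of K.  At boundary points the two agree as well, because
    both are continuous along the curve x + s^2 (b - x)
    ([plot_smooth_extends]). *)

(** * Calculus of smooth functions *)

Section smooth_calculus.
Context {R : realType}.
Implicit Types V W : normedModType R.

Lemma smooth_on_derive V W (U : set V) (f : V -> W) v :
  smooth_on U f -> smooth_on U ('D_v f).
Proof. by move=> sf k; have [_] := sf k.+1; exact. Qed.

Lemma smooth_on_differentiable V W (U : set V) (f : V -> W) x :
  smooth_on U f -> U x -> differentiable f x.
Proof. by move=> sf Ux; have [+ _] := sf 1%N; exact. Qed.

Lemma smooth_on_derivable V W (U : set V) (f : V -> W) x v :
  smooth_on U f -> U x -> derivable f x v.
Proof. by move=> sf Ux; exact/diff_derivable/smooth_on_differentiable/Ux. Qed.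

Lemma smooth_on_continuous V W (U : set V) (f : V -> W) x :
  smooth_on U f -> U x -> {for x, continuous f}.
Proof. by move=> sf; exact: (sf 0). Qed.

Lemma smooth_onS V W (U U' : set V) (f : V -> W) :
  U' `<=` U -> smooth_on U f -> smooth_on U' f.
Proof. by move=> UU' sf k; exact: Ck_on_sub (sf k). Qed.

Lemma smooth_on_eq V W (U : set V) (f g : V -> W) : open U ->
  (forall x, U x -> f x = g x) -> smooth_on U g -> smooth_on U f.
Proof.
by move=> oU fg sg k; apply: (Ck_on_eq oU _ (sg k)) => x; rewrite inE; exact: fg.
Qed.

Lemma smooth_on_cst V W (U : set V) (a : W) : smooth_on U (fun=> a).
Proof. by move=> k; exact: Ck_on_cst. Qed.

Lemma smooth_onD V W (U : set V) (f g : V -> W) : open U ->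
  smooth_on U f -> smooth_on U g -> smooth_on U (fun x => f x + g x).
Proof. by move=> oU sf sg k; exact: (Ck_onD oU (sf k) (sg k)). Qed.

Lemma smooth_onM V (U : set V) (f g : V -> R) : open U ->
  smooth_on U f -> smooth_on U g -> smooth_on U (fun x => f x * g x).
Proof. by move=> oU sf sg k; exact: (Ck_onM oU (sf k) (sg k)). Qed.

Lemma smooth_onZ V (U : set V) (f : V -> R) c : open U ->
  smooth_on U f -> smooth_on U (fun x => c * f x).
Proof. by move=> oU sf; apply: smooth_onM => //; exact: smooth_on_cst. Qed.

Lemma smooth_onB V (U : set V) (f g : V -> R) : open U ->
  smooth_on U f -> smooth_on U g -> smooth_on U (fun x => f x - g x).
Proof.
move=> oU sf sg; apply: smooth_onD => //.
apply: (@smooth_on_eq _ _ _ _ (fun x => -1 * g x)) => //; last exact: smooth_onZ.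
by move=> x _; rewrite mulN1r.
Qed.

Lemma smooth_on_sum V (U : set V) (I : Type) (r : seq I) (P : pred I)
    (f : I -> V -> R) : open U ->
  (forall i, P i -> smooth_on U (f i)) ->
  smooth_on U (fun x => \sum_(i <- r | P i) f i x).
Proof.
move=> oU sf; elim: r => [|i r IH].
  by under eq_fun do rewrite big_nil; exact: smooth_on_cst.
under eq_fun do rewrite big_cons.
by case: (boolP (P i)) => // Pi; apply: smooth_onD => //; exact: sf.
Qed.

Lemma smooth_on_prod V (U : set V) (I : Type) (r : seq I) (P : pred I)
    (f : I -> V -> R) : open U ->
  (forall i, P i -> smooth_on U (f i)) ->
  smooth_on U (fun x => \prod_(i <- r | P i) f i x).
Proof.
move=> oU sf; elim: r => [|i r IH].
  by under eq_fun do rewrite big_nil; exact: smooth_on_cst.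
under eq_fun do rewrite big_cons.
by case: (boolP (P i)) => // Pi; apply: smooth_onM => //; exact: sf.
Qed.

Lemma smooth_on_lin V W (U : set V) (f : {linear V -> W}) :
  continuous f -> smooth_on U f.
Proof.
move=> cf; case => [|k]; first by move=> x _; exact: cf.
split=> [x _|v]; first exact: linear_differentiable.
have -> : 'D_v f = cst (f v).
  apply/funext => x; rewrite deriveE; last exact: linear_differentiable.
  by rewrite diff_lin.
exact: Ck_on_cst.
Qed.

Lemma derive_coord n (x v : 'rV[R]_n) i :
  'D_v (fun x : 'rV[R]_n => x 0 i) x = v 0 i.
Proof.
have := @derive_mx R _ _ _ (@id (matrix R 1 n)) x v (@derivable_id R _ x v).
by rewrite derive_id => /matrixP/(_ 0 i) ->; rewrite mxE.
Qed.

Lemma smooth_on_coord n (U : set 'rV[R]_n) i :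
  smooth_on U (fun x : 'rV[R]_n => x 0 i).
Proof.
case => [|k]; first by move=> x _; exact: coord_continuous.
split=> [x _|v]; first exact: differentiable_coord.
under [X in Ck_on _ _ X]eq_fun do rewrite derive_coord.
exact: Ck_on_cst.
Qed.

Lemma smooth_on_comp_row V m (U : set V) (U' : set 'rV[R]_m) (f : 'rV[R]_m -> R)
    (g : V -> 'rV[R]_m) : open U -> (forall x, U x -> U' (g x)) ->
  smooth_on U' f -> (forall i, smooth_on U (fun x => g x 0 i)) ->
  smooth_on U (fun x => f (g x)).
Proof.
move=> oU UU' sf sg k.
have e x : g x = \row_i g x 0 i by apply/rowP => i; rewrite mxE.
under [X in Ck_on _ _ X]eq_fun do rewrite e.
apply: (@Ck_on_comp_row _ _ _ _ _ U' f (fun i x => g x 0 i)) => //.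
  by move=> x /UU'; rewrite -e.
by move=> i; exact: sg.
Qed.

Lemma derive_comp1 V (f : R -> R) (g : V -> R) x v :
  differentiable f (g x) -> differentiable g x ->
  'D_v (fun x => f (g x)) x = 'D_1 f (g x) * 'D_v g x.
Proof.
move=> df dg.
rewrite deriveE; last exact: (@differentiable_comp _ _ _ _ g f).
rewrite (@diff_comp _ _ _ _ g f) //= -(deriveE v dg).
have -> : 'D_v g x = 'D_v g x *: (1 : R) by rewrite /GRing.scale /= mulr1.
by rewrite linearZ /= -(deriveE (1:R) df) /GRing.scale /= !mulr1 mulrC.
Qed.

Lemma smooth_on_comp1 V (U : set V) (U' : set R) (f : R -> R) (g : V -> R) :
  open U -> (forall x, U x -> U' (g x)) ->
  smooth_on U' f -> smooth_on U g -> smooth_on U (fun x => f (g x)).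
Proof.
move=> oU UU' sf sg k; elim: k f sf => [|k IH] f sf.
  move=> x Ux; apply: (@continuous_comp _ _ _ g f); first exact: smooth_on_continuous Ux.
  by apply: (smooth_on_continuous sf); exact: UU'.
have df x : U x -> differentiable f (g x) by move=> /UU'; exact: smooth_on_differentiable.
have dg x : U x -> differentiable g x by exact: smooth_on_differentiable.
split=> [x Ux|v].
  by apply: (@differentiable_comp _ _ _ _ g f); [exact: dg|exact: df].
apply: (@Ck_on_eq R V R k U _ ((fun x : V => 'D_1 f (g x) : R) * 'D_v g)) => //.
  by move=> x; rewrite inE => Ux; rewrite derive_comp1//; [exact: df|exact: dg].
apply: Ck_onM => //; last exact: smooth_on_derive.
exact: (IH ('D_(1 : R) f) (smooth_on_derive (1 : R) sf)).
Qed.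

Lemma derive_basis n W (f : 'rV[R]_n -> W) x v : differentiable f x ->
  'D_v f x = \sum_i v 0 i *: 'D_(delta_mx 0 i) f x.
Proof.
move=> df; rewrite deriveE// {1}(row_sum_delta v) linear_sum.
by apply: eq_bigr => i _; rewrite linearZ /= deriveE.
Qed.

(** By linearity of the differential, only the coordinate directions have to be
    checked for C^k regularity. *)
Lemma smooth_on_basis n (U : set 'rV[R]_n) (f : 'rV[R]_n -> R) k : open U ->
  (forall x, U x -> differentiable f x) ->
  (forall i, Ck_on k U ('D_(delta_mx 0 i) f)) -> Ck_on k.+1 U f.
Proof.
move=> oU df sf; split=> // v.
apply: (@Ck_on_eq _ _ _ _ _ _
   (\sum_(i < n) (cst (v 0 i) * 'D_(delta_mx 0 i) f))) => //.
  move=> x; rewrite inE => Ux; rewrite derive_basis; last exact: df.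
  by rewrite fct_sumE.
by apply: Ck_on_sum => // i; apply: Ck_onM => //; exact: Ck_on_cst.
Qed.

Lemma smooth_onV V (U : set V) (f : V -> R) : open U ->
  (forall x, U x -> f x != 0) -> smooth_on U f ->
  smooth_on U (fun x => (f x)^-1).
Proof.
move=> oU f0 sf; elim => [|k IH].
  by move=> x Ux; apply: continuousV; [exact: f0|exact: smooth_on_continuous Ux].
split=> [x Ux|v].
  by apply: (@differentiableV _ _ f); [exact: smooth_on_differentiable Ux|exact: f0].
apply: (@Ck_on_eq _ _ _ _ _ _
   ((cst (-1)) * (((fun x => (f x)^-1) * (fun x => (f x)^-1)) * 'D_v f))) => //.
  move=> x; rewrite inE => Ux; rewrite (@deriveV _ _ f) ?f0//; last first.
    exact: smooth_on_derivable Ux.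
  by rewrite /cst /= !fctE mulN1r /GRing.scale /= mulNr -expr2 exprVn.
apply: Ck_onM => //; first exact: Ck_on_cst.
by apply: Ck_onM => //; [exact: Ck_onM|exact: smooth_on_derive].
Qed.

End smooth_calculus.
Arguments smooth_on_derivable {R V W U f x} v _ _.

(** * Uniform bounds on derivatives *)

Section dbound.
Context {R : realType} {n : nat}.

(** Only coordinate directions are differentiated, in all orders and all
    sequences up to length [k]; one constant serves for every order. *)
Fixpoint dbound (k : nat) (U : set 'rV[R]_n) (f : 'rV[R]_n -> R) (M : R) : Prop :=
  (forall x, U x -> `|f x| <= M) /\
  if k is k'.+1 then forall i, dbound k' U ('D_(delta_mx 0 i) f) M else True.

End dbound.

Section derivative_bounds.
Context {R : realType}.

Lemma dbound_le n k (U : set 'rV[R]_n) f M x : dbound k U f M -> U x -> `|f x| <= M.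
Proof. by case: k => [|k] [+ _]; exact. Qed.

Lemma dbound_ge0 n k (U : set 'rV[R]_n) f M x : dbound k U f M -> U x -> 0 <= M.
Proof. by move=> fM Ux; exact: le_trans (normr_ge0 _) (dbound_le fM Ux). Qed.

Lemma dbound_pred n k (U : set 'rV[R]_n) f M : dbound k.+1 U f M -> dbound k U f M.
Proof.
elim: k f => [|k IH] f; first by case=> fM _.
by move=> [fM dM]; split=> // i; exact/IH/dM.
Qed.

Lemma dboundW n k k' (U U' : set 'rV[R]_n) f M M' : (k' <= k)%N -> U' `<=` U ->
  M <= M' -> dbound k U f M -> dbound k' U' f M'.
Proof.
move=> kk UU MM /= fM; have {}fM : dbound k' U f M.
  move: fM; rewrite -(subnK kk); elim: (k - k')%N => // m IH.
  by rewrite addSn => /dbound_pred.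
elim: k' {kk} f fM => [|k' IH] f [fM dM].
  by split=> // x /UU /fM /le_trans; exact.
by split=> [x /UU /fM /le_trans|i]; [exact|exact/IH/dM].
Qed.

Lemma dbound_weaken n k (U : set 'rV[R]_n) f M M' : M <= M' ->
  dbound k U f M -> dbound k U f M'.
Proof. by move=> MM; apply: dboundW. Qed.

(** Bounds on derivatives are local, which allows a function to be replaced by
    a different expression near each point. *)
Lemma dbound_local n k (U : set 'rV[R]_n) f M :
  (forall x, U x -> exists A g, [/\ open A, A x, forall y, A y -> f y = g y
     & dbound k A g M]) -> dbound k U f M.
Proof.
elim: k U f => [|k IH] U f fg.
  by split=> // x /fg[A [g [_ Ax fgE [gM _]]]]; rewrite fgE//; exact: gM.
split=> [x /fg[A [g [_ Ax fgE [gM _]]]]|i]; first by rewrite fgE//; exact: gM.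
apply: IH => x /fg[A [g [oA Ax fgE [_ dg]]]].
exists A, ('D_(delta_mx 0 i) g); split=> // [y Ay|]; last exact: dg.
by apply: near_eq_derive; near=> z; apply: fgE; near: z; exact: open_nbhs_nbhs.
Unshelve. all: by end_near. Qed.

Lemma dbound_eq n k (U : set 'rV[R]_n) f g M : open U ->
  (forall x, U x -> f x = g x) -> dbound k U g M -> dbound k U f M.
Proof. by move=> oU fg gM; apply: dbound_local => x Ux; exists U, g. Qed.

Lemma dbound0 n k (U : set 'rV[R]_n) M : 0 <= M -> dbound k U (fun=> 0) M.
Proof.
move=> M0; elim: k => [|k IH].
  by split=> // x _; rewrite normr0.
split=> [x _|i]; first by rewrite normr0.
have -> // : 'D_(delta_mx 0 i) (fun=> 0 : R) = (fun=> 0) :> ('rV[R]_n -> R).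
by apply/funext => x; exact: (@derive_cst _ _ _ (0 : R)).
Qed.

Lemma dboundD n k (U : set 'rV[R]_n) f g M N : open U ->
  smooth_on U f -> smooth_on U g -> dbound k U f M -> dbound k U g N ->
  dbound k U (fun x => f x + g x) (M + N).
Proof.
move=> oU; elim: k f g => [|k IH] f g sf sg [fM df] [gN dg]; split=> //.
- by move=> x Ux; rewrite (le_trans (ler_normD _ _))// lerD ?fM ?gN.
- by move=> x Ux; rewrite (le_trans (ler_normD _ _))// lerD ?fM ?gN.
move=> i; apply: (@dbound_eq _ _ _ _
    (fun x => 'D_(delta_mx 0 i) f x + 'D_(delta_mx 0 i) g x)) => //.
  move=> x Ux; have fx := smooth_on_derivable (delta_mx 0 i) sf Ux.
  have gx := smooth_on_derivable (delta_mx 0 i) sg Ux.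
  exact: deriveD fx gx.
apply: IH; [exact: smooth_on_derive|exact: smooth_on_derive|exact: df|exact: dg].
Qed.

Lemma dboundM n k (U : set 'rV[R]_n) f g M N : open U ->
  smooth_on U f -> smooth_on U g -> dbound k U f M -> dbound k U g N ->
  dbound k U (fun x => f x * g x) (2 ^+ k * (M * N)).
Proof.
move=> oU; elim: k f g => [|k IH] f g sf sg fM gN.
  split=> // x Ux; rewrite expr0 mul1r normrM ler_pM//.
    exact: (dbound_le fM Ux).
  exact: (dbound_le gN Ux).
split=> [x Ux|i].
  rewrite normrM (@le_trans _ _ (1 * (M * N)))//.
    by rewrite mul1r ler_pM// ?(dbound_le fM Ux) ?(dbound_le gN Ux).
  rewrite ler_wpM2r ?exprn_ege1 ?ler1n// mulr_ge0// ?(dbound_ge0 fM Ux) ?(dbound_ge0 gN Ux)//.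
apply: (@dbound_eq _ _ _ _ (fun x => f x * 'D_(delta_mx 0 i) g x +
                               'D_(delta_mx 0 i) f x * g x)) => //.
  move=> x Ux; have fx := smooth_on_derivable (delta_mx 0 i) sf Ux.
  have gx := smooth_on_derivable (delta_mx 0 i) sg Ux.
  by have -> := deriveM fx gx; congr (_ + _); exact: mulrC.
have -> : 2 ^+ k.+1 * (M * N) = 2 ^+ k * (M * N) + 2 ^+ k * (M * N).
  by rewrite exprS -mulrA mulr_natl mulr2n.
have dsf := smooth_on_derive (delta_mx 0 i) sf.
have dsg := smooth_on_derive (delta_mx 0 i) sg.
apply: dboundD => //; [exact: smooth_onM|exact: smooth_onM| |].
  by apply: IH => //; [exact: dbound_pred|exact: gN.2].
by apply: IH => //; [exact: fM.2|exact: dbound_pred].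
Qed.

Lemma dboundZ n k (U : set 'rV[R]_n) f M c : open U ->
  smooth_on U f -> dbound k U f M ->
  dbound k U (fun x => c * f x) (`|c| * M).
Proof.
move=> oU; elim: k f => [|k IH] f sf [fM dM]; split=> //.
- by move=> x Ux; rewrite normrM ler_wpM2l// fM.
- by move=> x Ux; rewrite normrM ler_wpM2l// fM.
move=> i; apply: (@dbound_eq _ _ _ _ (fun x => c * 'D_(delta_mx 0 i) f x)) => //.
  move=> x Ux; exact: (deriveZ c (smooth_on_derivable (delta_mx 0 i) sf Ux)).
by apply: IH; [exact: smooth_on_derive|exact: dM].
Qed.

Lemma dbound_sum n k (U : set 'rV[R]_n) (I : Type) (r : seq I) (P : pred I)
    (f : I -> 'rV[R]_n -> R) (M : R) : open U -> 0 <= M ->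
  (forall i, P i -> smooth_on U (f i)) ->
  (forall i, P i -> dbound k U (f i) M) ->
  dbound k U (fun x => \sum_(i <- r | P i) f i x) ((size r)%:R * M).
Proof.
move=> oU M0 sf fM; elim: r => [|i r IH].
  by under eq_fun do rewrite big_nil; rewrite mul0r; exact: dbound0.
under eq_fun do rewrite big_cons.
rewrite /= -natr1 mulrDl mul1r addrC.
case: (boolP (P i)) => [Pi|_].
  by apply: dboundD => //; [exact: sf|exact: smooth_on_sum|exact: fM].
by apply: dbound_weaken IH; rewrite lerDr.
Qed.

Lemma dbound_prod n k (U : set 'rV[R]_n) (I : Type) (r : seq I)
    (f : I -> 'rV[R]_n -> R) (M : R) : open U -> 0 <= M ->
  (forall i, smooth_on U (f i)) -> (forall i, dbound k U (f i) M) ->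
  dbound k U (fun x => \prod_(i <- r) f i x) ((2 ^+ k * M) ^+ size r).
Proof.
move=> oU M0 sf fM; elim: r => [|i r IH].
  under eq_fun do rewrite big_nil.
  rewrite expr0; case: k {fM} => [|k].
    by split=> // x _; rewrite normr1.
  split=> [x _|j]; first by rewrite normr1.
  have -> : 'D_(delta_mx 0 j) (fun=> 1 : R) = (fun=> 0) :> ('rV[R]_n -> R).
    by apply/funext => x; exact: (@derive_cst _ _ _ (1 : R)).
  exact: dbound0.
under eq_fun do rewrite big_cons.
rewrite /= exprS -mulrA.
by apply: dboundM => //; exact: smooth_on_prod.
Qed.

Lemma derive_line n (f : 'rV[R]_n -> R) (x v : 'rV[R]_n) (t : R) :
  'D_(1 : R) (fun s : R => f (x + s *: v)) t = 'D_v f (x + t *: v).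
Proof.
rewrite /derive; set g := (X in lim (X @ _)).
set g' := (X in _ = lim (X @ _)); suff -> : g = g' by [].
apply/funext => h; rewrite /g /g' /=.
by rewrite scalerDl [h *: 1]mulr1 addrCA.
Qed.

Lemma derivable_line n (f : 'rV[R]_n -> R) (x v : 'rV[R]_n) (t : R) :
  derivable f (x + t *: v) v ->
  derivable (fun s : R => f (x + s *: v)) t (1 : R).
Proof.
rewrite /derivable; set g := (X in cvg (X @ _) -> _).
set h := (X in _ -> cvg (X @ _)); suff -> : h = g by [].
apply/funext => s /=.
by rewrite /h/g /= scalerDl [s *: 1]mulr1 addrCA.
Qed.

Lemma is_derive_line n (f : 'rV[R]_n -> R) (x v : 'rV[R]_n) (t : R) :
  differentiable f (x + t *: v) ->
  is_derive t (1 : R) (fun s : R => f (x + s *: v)) ('D_v f (x + t *: v)).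
Proof.
move=> df; have /derivable_line/derivableP := @diff_derivable _ _ _ f _ v df.
by rewrite derive_line.
Qed.

Lemma derive_dbound n (U : set 'rV[R]_n) f (v x : 'rV[R]_n) M :
  differentiable f x -> dbound 1 U f M -> U x ->
  `|'D_v f x| <= n%:R * M * `|v|.
Proof.
move=> df fM Ux; rewrite derive_basis// (le_trans (ler_norm_sum _ _ _))//.
have -> : n%:R * M * `|v| = \sum_(i < n) `|v| * M.
  by rewrite sumr_const card_ord -[RHS]mulr_natl; ring.
apply: ler_sum => i _; rewrite normrM ler_pM//.
  by rewrite [leRHS]mx_normrE; exact: (le_bigmax _ _ (0, i)).
exact: ((fM.2 i).1 _ Ux).
Qed.

Lemma mean_value_line n (f : 'rV[R]_n -> R) (x y : 'rV[R]_n) :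
  (forall t : R, 0 <= t <= 1 -> differentiable f (x + t *: (y - x))) ->
  exists2 c : R, 0 <= c <= 1 & f y - f x = 'D_(y - x) f (x + c *: (y - x)).
Proof.
move=> df; pose phi (t : R) := f (x + t *: (y - x)).
have dphi (t : R) : 0 <= t <= 1 ->
    is_derive t (1 : R) phi ('D_(y - x) f (x + t *: (y - x))).
  by move=> t01; apply: is_derive_line; apply: df.
have [||c] := @MVT R phi (fun t => 'D_(y - x) f (x + t *: (y - x))) 0 1 ltr01.
- by move=> t; rewrite in_itv/= => /andP[t0 t1]; apply: dphi; rewrite !ltW.
- apply: derivable_within_continuous => t; rewrite in_itv/= => t01.
  by have := dphi t t01; case.
rewrite in_itv/= /phi scale1r scale0r addr0 subr0 mulr1 addrCA subrr addr0 => c01 ->.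
by exists c => //; case/andP : c01 => c0 c1; rewrite !ltW.
Qed.

Lemma dbound_lipschitz n (U : set 'rV[R]_n) f (x y : 'rV[R]_n) M :
  (forall z, U z -> differentiable f z) -> dbound 1 U f M ->
  (forall t, 0 <= t <= 1 -> U (x + t *: (y - x))) ->
  `|f y - f x| <= n%:R * M * `|y - x|.
Proof.
move=> df fM Uxy.
have [t t01|c c01 ->] := @mean_value_line n f x y; first by apply: df; exact: Uxy.
apply: (derive_dbound _ _ fM); last exact: Uxy.
by apply: df; exact: Uxy.
Qed.

Definition dil n (b : 'rV[R]_n) (q : R) (x : 'rV[R]_n) := b + q *: (x - b).

Lemma dil_coord n (b : 'rV[R]_n) q x i :
  dil b q x 0 i = b 0 i + q * (x 0 i - b 0 i).
Proof. by rewrite !mxE. Qed.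

Lemma continuous_dil n (b : 'rV[R]_n) q : continuous (dil b q).
Proof.
have -> : dil b q = cst b + (q \*: (id - cst b)) by [].
move=> x; apply: continuousD; first exact: cst_continuous.
by apply: continuousZl_tmp; apply: continuousB => //; exact: cst_continuous.
Qed.

Lemma smooth_on_dil n (V U : set 'rV[R]_n) (h : 'rV[R]_n -> R) b q : open V ->
  (forall x, V x -> U (dil b q x)) -> smooth_on U h ->
  smooth_on V (fun x => h (dil b q x)).
Proof.
move=> oV VU sh; apply: (smooth_on_comp_row oV VU sh) => i.
under eq_fun do rewrite dil_coord.
apply: smooth_onD => //; first exact: smooth_on_cst.
apply: smooth_onZ => //; apply: smooth_onB => //; last exact: smooth_on_cst.
exact: smooth_on_coord.
Qed.

Lemma derive_dil n (h : 'rV[R]_n -> R) b q v x : differentiable h (dil b q x) ->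
  'D_v (fun x => h (dil b q x)) x = q * 'D_v h (dil b q x).
Proof.
move=> dh.
have -> : q * 'D_v h (dil b q x) = 'D_(q *: v) h (dil b q x).
  by rewrite !deriveE// linearZ.
have := derive_line h (dil b q x) (q *: v) 0.
have := derive_line (fun x => h (dil b q x)) x v 0.
rewrite !scale0r !addr0 => <- <-.
set f := (X in derive X); set g := (X in _ = derive X _ _); suff -> : f = g by [].
apply/funext => s; rewrite /f /g; congr h.
by apply/rowP => i; rewrite !mxE; ring.
Qed.

Lemma dbound_dil n k (V U : set 'rV[R]_n) (h : 'rV[R]_n -> R) b q M : open V ->
  (forall x, V x -> U (dil b q x)) -> 0 <= q <= 1 -> smooth_on U h ->
  dbound k U h M -> dbound k V (fun x => h (dil b q x)) M.
Proof.
move=> oV VU /andP[q0 q1]; elim: k h => [|k IH] h sh hM.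
  by split=> // x /VU; exact: (dbound_le hM).
split=> [x /VU|i]; first exact: (dbound_le hM).
apply: (@dbound_eq _ _ _ _ (fun x => q * 'D_(delta_mx 0 i) h (dil b q x))) => //.
  by move=> x Vx; apply: derive_dil; apply: (smooth_on_differentiable sh); exact: VU.
have sdh := smooth_on_derive (delta_mx 0 i) sh.
have hiM := IH _ sdh (hM.2 i).
have [[x Vx]|V0] := pselect (exists x, V x); last first.
  by apply: dbound_local => x Vx; case: V0; exists x.
apply: dbound_weaken (dboundZ q oV (smooth_on_dil oV VU sdh) hiM) => //.
by rewrite ger0_norm// ler_piMl// (dbound_ge0 hiM Vx).
Qed.

(** A homothety with ratio at most 1 does not increase bounds on derivatives, so
    this is the triangle inequality. *)
Lemma dbound_sub_dil n k (U : set 'rV[R]_n) (h : 'rV[R]_n -> R) b q M : open U ->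
  (forall x, U x -> U (dil b q x)) -> 0 <= q <= 1 -> smooth_on U h ->
  dbound k U h M -> dbound k U (fun x => h x - h (dil b q x)) (2 * M).
Proof.
move=> oU UU q01 sh hM.
apply: (@dbound_eq _ _ _ _ (fun x => h x + -1 * h (dil b q x))) => //.
  by move=> x _; rewrite mulN1r.
have sd := smooth_on_dil oU UU sh.
apply: (@dbound_weaken _ _ _ _ (M + `|-1| * M)).
  by rewrite normrN1 mul1r mulr_natl mulr2n.
have sZ := smooth_onZ (-1) oU sd.
exact: dboundD oU sh sZ hM (dboundZ (-1) oU sd (dbound_dil oU UU q01 sh hM)).
Qed.

(** The difference is small because [h] is Lipschitz along the segment from [x]
    to its image, of length (1 - q) |x - b|.  The factor [c] is there for the
    induction: differentiating turns [c] into [c * q], and 1 - c q is still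
    proportional to 1 - q, with [a] replaced by [a + 1]. *)
Lemma dbound_sub_dil_small n k (U : set 'rV[R]_n) (h : 'rV[R]_n -> R) b (q c L a M : R) :
  open U -> (forall x t, U x -> 0 <= t <= 1 -> U (dil b t x)) ->
  (forall x, U x -> `|x - b| <= L) -> 0 <= q <= 1 ->
  0 <= c <= 1 -> 1 - c <= a * (1 - q) ->
  smooth_on U h -> dbound k.+1 U h M ->
  dbound k U (fun x => h x - c * h (dil b q x))
    ((n%:R * L + a + k%:R) * (1 - q) * M).
Proof.
move=> oU st UL q01 c01 ca sh hM.
have UU x : U x -> U (dil b q x) by move=> Ux; exact: st.
have [q0 q1] := andP q01.
elim: k h c a c01 ca sh hM => [|k IH] h c a c01 ca sh hM.
  split=> // x Ux.
  have M0 := dbound_ge0 hM Ux.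
  rewrite addr0 mulrDl mulrDl.
  have -> : h x - c * h (dil b q x) = (h x - h (dil b q x)) + (1 - c) * h (dil b q x).
    by ring.
  rewrite (le_trans (ler_normD _ _))// lerD//.
    have xE : x - dil b q x = (1 - q) *: (x - b).
      by rewrite /dil opprD addrA scalerBl scale1r.
    apply: (@le_trans _ _ (n%:R * M * `|x - dil b q x|)).
      apply: (@dbound_lipschitz _ U) => //.
        by move=> z Uz; exact: smooth_on_differentiable Uz.
      move=> t /andP[t0 t1].
      have -> : dil b q x + t *: (x - dil b q x) = dil b (q + t * (1 - q)) x.
        by rewrite xE scalerA /dil -addrA -scalerDl.
      apply: st => //; nra.
    rewrite xE normrZ ger0_norm ?subr_ge0//.
    have xL := UL _ Ux.
    have -> : n%:R * L * (1 - q) * M = n%:R * M * ((1 - q) * L) by ring.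
    by rewrite ler_wpM2l ?mulr_ge0// ler_wpM2l ?subr_ge0.
  rewrite normrM ler_pM//; last exact: (dbound_le hM (UU _ Ux)).
  by case/andP : c01 => c0 c1; rewrite ger0_norm ?subr_ge0.
have sd := smooth_on_dil oU UU sh.
split=> [x Ux|i].
  have M0 := dbound_ge0 hM Ux; have L0 := le_trans (normr_ge0 _) (UL _ Ux).
  have /dbound_le/(_ Ux) /le_trans := IH h c a c01 ca sh (dbound_pred hM); apply.
  rewrite ler_wpM2r// ler_wpM2r ?subr_ge0// lerD2l ler_nat //.
have -> : n%:R * L + a + k.+1%:R = n%:R * L + (a + 1) + k%:R.
  by rewrite -natr1; ring.
apply: (@dbound_eq _ _ _ _ (fun x => 'D_(delta_mx 0 i) h x -
     (c * q) * 'D_(delta_mx 0 i) h (dil b q x))) => //; last first.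
  have [c0 c1] := andP c01; apply: IH; first nra.
  - nra.
  - exact: smooth_on_derive.
  - exact: hM.2.
move=> x Ux; have dh := smooth_on_differentiable sh (UU _ Ux).
have dhx := smooth_on_derivable (delta_mx 0 i) sh Ux.
have dhq := smooth_on_derivable (delta_mx 0 i) sd Ux.
have -> : (fun x => h x - c * h (dil b q x)) = h - c *: (fun x => h (dil b q x)) by [].
have dcq := @derivableZ _ _ _ _ c _ _ dhq.
rewrite (deriveB dhx dcq) (deriveZ c dhq) derive_dil//.
by rewrite -mulrA.
Qed.

End derivative_bounds.

(** * Rapidly converging series of smooth functions *)

Section smooth_series.
Context {R : realType}.

Lemma is_cvg_geometric_bound (a : nat -> R) (C : R) :
  (forall j, `|a j| <= C / 2 ^+ j) -> cvgn (series a).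
Proof.
move=> aC; apply: normed_cvg.
have C0 : 0 <= C by have := le_trans (normr_ge0 _) (aC 0); rewrite expr0 divr1.
apply: (@series_le_cvg _ _ (geometric C 2^-1)) => /= [j|j|j|].
- exact: normr_ge0.
- by rewrite mulr_ge0// exprn_ge0.
- by rewrite exprVn; exact: aC.
- by apply: is_cvg_geometric_series; rewrite ger0_norm// invf_lt1// ltr1n.
Qed.

Lemma series_geometric_bound (a : nat -> R) (C : R) J :
  (forall j, `|a j| <= C / 2 ^+ j) -> `|series a J| <= C * 2.
Proof.
move=> aC.
have C0 : 0 <= C by have := le_trans (normr_ge0 _) (aC 0); rewrite expr0 divr1.
suff : `|series a J| <= C * 2 - C * 2 / 2 ^+ J.
  by move/le_trans; apply; rewrite gerBl divr_ge0// ?exprn_ge0// mulr_ge0.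
elim: J => [|J IH].
  by rewrite /series /= big_geq// normr0 expr0 divr1 subrr.
rewrite /series /= big_nat_recr//=.
rewrite (le_trans (ler_normD _ _))// (le_trans (lerD IH (aC J)))//.
rewrite exprS invfM.
by rewrite le_eqVlt; apply/orP; left; apply/eqP; field; rewrite expf_neq0.
Qed.

(** A quadratic error estimate alone gives differentiability with zero
    derivative; no candidate differential has to be built. *)
Lemma diff_quadratic (V W : normedModType R) (r : V -> W) (x : V) (C : R) :
  (forall v, `|r (x + v) - r x| <= C * `|v| ^+ 2) ->
  differentiable r x /\ forall v, 'D_v r x = 0.
Proof.
move=> rC.
have E : r \o shift x = cst (r x) + (\0 : {linear V -> W}) +o_ 0 id.
  apply/eqaddoP => e e0; near=> h.
  rewrite !fctE /= addr0 [h + x]addrC (le_trans (rC h))// expr2 mulrA.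
  rewrite ler_wpM2r//.
  have hC : `|h| < e / (`|C| + 1).
    by near: h; apply: nbhs0_lt; rewrite divr_gt0// ltr_wpDl.
  rewrite (@le_trans _ _ ((`|C| + 1) * `|h|))//.
    by rewrite ler_wpM2r// (le_trans (ler_norm _))// lerDl.
  by rewrite mulrC -ler_pdivlMr ?ltr_wpDl// ltW.
have c0 : continuous (\0 : {linear V -> W}) by move=> y; exact: cst_continuous.
have dr := differentiable_of c0 E.
by split=> // v; rewrite deriveE// (diff_unique c0 E).
Unshelve. all: by end_near. Qed.

(** Two applications of the mean value theorem: one to the increment of [h],
    one to its partial derivatives. *)
Lemma taylor1_dbound n (h : 'rV[R]_n -> R) (x v : 'rV[R]_n) M :
  smooth_on setT h -> dbound 2 setT h M ->
  `|h (x + v) - h x - \sum_i v 0 i * 'D_(delta_mx 0 i) h x|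
    <= n%:R * (n%:R * M) * `|v| ^+ 2.
Proof.
move=> sh hM; have dh y : differentiable h y by exact: (smooth_on_differentiable sh).
have [//|c c01 ->] := @mean_value_line _ _ h x (x + v).
have -> : x + v - x = v by rewrite addrAC subrr add0r.
rewrite derive_basis// -sumrB.
rewrite (le_trans (ler_norm_sum _ _ _))//.
have -> : n%:R * (n%:R * M) * `|v| ^+ 2 =
    \sum_(i < n) `|v| * (n%:R * M * `|v|).
  by rewrite sumr_const card_ord -[RHS]mulr_natl; ring.
apply: ler_sum => i _; rewrite -mulrBr normrM ler_pM//.
  by rewrite [leRHS]mx_normrE; exact: (le_bigmax _ _ (0, i)).
have xv : x + c *: v - x = c *: v by rewrite addrAC subrr add0r.
have sdh := smooth_on_derive (delta_mx 0 i) sh.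
have lip := @dbound_lipschitz _ n setT _ x (x + c *: v) M
  (fun z Iz => smooth_on_differentiable sdh Iz) (hM.2 i) (fun _ _ => I).
apply: le_trans lip _.
have M0 : 0 <= M := dbound_ge0 (x := x) hM I.
rewrite xv ler_wpM2l ?mulr_ge0// normrZ ler_piMl//.
by case/andP : c01 => c0 c1; rewrite ger0_norm.
Qed.

Definition fast_series n (h : nat -> 'rV[R]_n -> R) :=
  (forall j, smooth_on setT (h j)) /\
  forall k, exists C, forall j, dbound k setT (h j) (C / 2 ^+ j).

Definition sum_series n (h : nat -> 'rV[R]_n -> R) (x : 'rV[R]_n) : R :=
  limn (series (h ^~ x)).

Lemma fast_series_cvg n (h : nat -> 'rV[R]_n -> R) x : fast_series h ->
  series (h ^~ x) @ \oo --> sum_series h x.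
Proof.
move=> [_ /(_ 0%N)[C hC]]; apply: (@is_cvg_geometric_bound _ C) => j.
exact: (dbound_le (hC j)).
Qed.

Lemma fast_series_derive n (h : nat -> 'rV[R]_n -> R) i : fast_series h ->
  fast_series (fun j => 'D_(delta_mx 0 i) (h j)).
Proof.
move=> [sh hC]; split=> [j|k]; first exact: smooth_on_derive.
by have [C hk] := hC k.+1; exists C => j; exact: (hk j).2.
Qed.

(** With L the linear form given by the sums of the partial derivatives, the
    increments of F - L are the sums of the first-order Taylor remainders of the
    terms, hence quadratically small. *)
Lemma sum_series_diff n (h : nat -> 'rV[R]_n -> R) x : fast_series h ->
  differentiable (sum_series h) x /\
  forall i, 'D_(delta_mx 0 i) (sum_series h) x =
            sum_series (fun j => 'D_(delta_mx 0 i) (h j)) x.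
Proof.
move=> fh; set F := sum_series h.
pose G i := sum_series (fun j => 'D_(delta_mx 0 i) (h j)) x.
pose L (y : 'rV[R]_n) := \sum_i G i * y 0 i.
have sL : smooth_on setT L.
  by apply: smooth_on_sum => [|i _]; [exact: openT|
     apply: smooth_onZ; [exact: openT|exact: smooth_on_coord]].
have LB y z : L (y + z) - L y = L z.
  rewrite /L -sumrB; apply: eq_bigr => i _; rewrite mxE; ring.
have [sh /(_ 2)[C hC]] := fh.
have rq v : `|(F - L) (x + v) - (F - L) x| <=
    (n%:R * (n%:R * C) * 2) * `|v| ^+ 2.
  rewrite !fctE.
  have -> : F (x + v) - L (x + v) - (F x - L x) = F (x + v) - F x - L v.
    by rewrite -(LB x v); ring.
  pose u j := h j (x + v) - h j x - \sum_i v 0 i * 'D_(delta_mx 0 i) (h j) x.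
  have uE J : series u J = series (h ^~ (x + v)) J - series (h ^~ x) J -
      \sum_i series (fun j => 'D_(delta_mx 0 i) (h j) x) J * v 0 i.
    rewrite /series /= /u !sumrB; congr (_ - _); rewrite exchange_big/=.
    by apply: eq_bigr => i _; rewrite mulr_suml; apply: eq_bigr => j _; rewrite mulrC.
  have cu : series u @ \oo --> F (x + v) - F x - L v.
    rewrite (_ : series u = fun J => series (h ^~ (x + v)) J - series (h ^~ x) J -
      \sum_i series (fun j => 'D_(delta_mx 0 i) (h j) x) J * v 0 i); last exact/funext.
    apply: cvgB; first by apply: cvgB; exact: fast_series_cvg.
    apply: cvg_big => [|i _]; first exact: add_continuous.
    apply: cvgM; last exact: cvg_cst.
    exact: (@fast_series_cvg _ _ x (fast_series_derive i fh)).
  have cnu : (fun J => `|series u J|) @ \oo --> `|F (x + v) - F x - L v|.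
    exact: cvg_norm cu.
  rewrite -(cvg_lim _ cnu)//; apply: limr_le; first by apply/cvg_ex; eexists; exact: cnu.
  near=> J.
  have -> : n%:R * (n%:R * C) * 2 * `|v| ^+ 2 = (n%:R * (n%:R * C) * `|v| ^+ 2) * 2.
    by ring.
  apply: series_geometric_bound => j.
  have -> : n%:R * (n%:R * C) * `|v| ^+ 2 / 2 ^+ j =
    n%:R * (n%:R * (C / 2 ^+ j)) * `|v| ^+ 2 by ring.
  exact: taylor1_dbound.
have [dr r0] := diff_quadratic rq.
have dL := smooth_on_differentiable sL (x := x) I.
have FE : F = (F - L) + L by apply/funext => y; rewrite !fctE subrK.
split=> [|i]; first by rewrite FE; exact: differentiableD.
rewrite FE deriveD; [|exact: diff_derivable|exact: diff_derivable].
rewrite r0 add0r.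
have -> : L = \sum_i (G i *: (fun y : 'rV[R]_n => y 0 i)) :> ('rV[R]_n -> R).
  by apply/funext => y; rewrite fct_sumE.
rewrite derive_sum; last first.
  move=> j; apply: derivableZ; apply: diff_derivable.
  exact: (smooth_on_differentiable (@smooth_on_coord _ _ setT _)).
rewrite (bigD1 i)//= big1 ?addr0 => [|j ji].
  rewrite deriveZ; first by rewrite derive_coord mxE !eqxx [LHS]mulr1.
  apply: diff_derivable; exact: (smooth_on_differentiable (@smooth_on_coord _ _ setT _)).
rewrite deriveZ; first by rewrite derive_coord mxE (negbTE ji) [LHS]mulr0.
apply: diff_derivable; exact: (smooth_on_differentiable (@smooth_on_coord _ _ setT _)).
Unshelve. all: by end_near. Qed.

Lemma smooth_sum_series n (h : nat -> 'rV[R]_n -> R) : fast_series h ->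
  smooth_on setT (sum_series h).
Proof.
move=> + k; elim: k h => [|k IH] h fh.
  by move=> x _; apply: differentiable_continuous; have [] := sum_series_diff x fh.
apply: smooth_on_basis; first exact: openT.
  by move=> x _; have [] := sum_series_diff x fh.
move=> i; rewrite (_ : 'D_(delta_mx 0 i) _ =
    sum_series (fun j => 'D_(delta_mx 0 i) (h j))).
  by apply: IH; exact: fast_series_derive.
by apply/funext => x; have [_] := sum_series_diff x fh; exact.
Qed.

End smooth_series.

(** * Bump functions *)

Section smooth_bumps.
Context {R : realType}.

(** The functions p(1/t) exp(-1/t), extended by 0: a family that contains the
    classical flat function and is closed under differentiation. *)
Definition flat_exp (p : {poly R}) (t : R) : R :=
  if 0 < t then p.[t^-1] * expR (- t^-1) else 0.

(** The derivative of p(1/t) exp(-1/t) is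
    (1/t)^2 (p(1/t) - p'(1/t)) exp(-1/t). *)
Definition flat_exp_next (p : {poly R}) : {poly R} := 'X^2 * (p - p^`()).

(** The exponential dominates the term of degree i + 2 of its series. *)
Lemma expR_decay (x : R) (i : nat) : 0 < x ->
  x ^+ i * expR (- x) <= (i.+2)`!%:R * (x^-1) ^+ 2.
Proof.
move=> x0; rewrite expRN ler_pdivrMr ?expR_gt0//.
have := expR_ge1Dxn i.+1 (ltW x0); move=> /(le_trans _) h.
have {h} : x ^+ i.+2 / (i.+2)`!%:R <= expR x by apply: h; rewrite lerDr.
rewrite ler_pdivrMr ?ltr0n ?fact_gt0// => h.
rewrite mulrAC exprVn ler_pdivlMr ?exprn_gt0// -exprD addn2.
by rewrite mulrC.
Qed.

Lemma flat_exp_quadratic p : exists C, forall t, `|flat_exp p t| <= C * `|t| ^+ 2.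
Proof.
exists (\sum_(i < size p) `|p`_i| * (i.+2)`!%:R) => t; rewrite /flat_exp.
case: ltP => [t0|_]; last first.
  by rewrite normr0 mulr_ge0// ?exprn_ge0// sumr_ge0// => i _; rewrite mulr_ge0.
rewrite horner_coef mulr_suml (le_trans (ler_norm_sum _ _ _))// mulr_suml.
apply: ler_sum => i _; rewrite -!mulrA normrM ler_wpM2l//.
rewrite ger0_norm; last by rewrite mulr_ge0 ?expR_ge0 ?exprn_ge0 ?invr_ge0 ?ltW.
have := @expR_decay t^-1 i; rewrite invrK invr_gt0 => /(_ t0).
by rewrite (gtr0_norm t0).
Qed.

(** Away from 0 the formula is differentiated directly; at 0 the quadratic decay
    ([flat_exp_quadratic]) gives derivative 0. *)
Lemma is_derive_flat_exp p (t : R) : is_derive t (1 : R) (flat_exp p) (flat_exp (flat_exp_next p) t).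
Proof.
have [t0|t0|->] := ltgtP t 0.
- rewrite {2}/flat_exp ltNge (ltW t0)/=.
  apply: (@near_eq_is_derive _ _ _ (cst 0)).
  near=> s; rewrite /flat_exp ltNge ifF//; apply/negbTE; rewrite negbK ltW//.
  near: s; exact: lt_nbhsl.
- rewrite {2}/flat_exp t0.
  pose i (s : R) := s^-1.
  have di : is_derive t (1 : R) i (- (t ^- 2)).
    apply: is_derive_eq (@is_deriveV _ id t 1 1 _ _) _.
      by rewrite gt_eqF.
    by rewrite /= [LHS]mulr1.
  have dp : is_derive t (1 : R) (horner p \o i) (p^`().[t^-1] * - (t ^- 2)).
    exact: is_derive1_comp.
  have dni : is_derive t (1 : R) (- i) (t ^- 2).
    by apply: is_derive_eq (is_deriveN di) _; rewrite opprK.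
  have de : is_derive t (1 : R) (expR \o (- i)) (expR (- t^-1) * (t ^- 2)).
    exact: is_derive1_comp.
  apply: (@near_eq_is_derive _ _ _ ((horner p \o i) * (expR \o (- i)))).
    near=> s; rewrite /flat_exp ifT; first by rewrite /i !fctE.
    by near: s; exact: lt_nbhsr.
  apply: is_derive_eq (is_deriveM dp de) _.
  rewrite /i !fctE /= /flat_exp_next !hornerE /= exprVn /GRing.scale /=.
  by ring.
- have [C pC] := flat_exp_quadratic p.
  have f0 q : flat_exp q 0 = 0 by rewrite /flat_exp ltxx.
  have [|d d0] := @diff_quadratic _ _ _ (flat_exp p) 0 C.
    by move=> v; rewrite f0 subr0 add0r.
  rewrite f0; apply: DeriveDef; [exact: diff_derivable|exact: d0].
Unshelve. all: by end_near. Qed.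

Lemma smooth_flat_exp p : smooth_on setT (flat_exp p).
Proof.
move=> k; elim: k p => [|k IH] p.
  move=> t _; apply: differentiable_continuous; apply/derivable1_diffP.
  by have [] := is_derive_flat_exp p t.
have dp t : differentiable (flat_exp p) t.
  by apply/derivable1_diffP; have [] := is_derive_flat_exp p t.
split=> [t _|v]; first exact: dp.
apply: (@Ck_on_eq _ _ _ _ _ _ (cst v * flat_exp (flat_exp_next p))); first exact: openT.
  move=> t _; rewrite deriveE//.
  have -> : v = v *: (1 : R) by rewrite [v *: _]mulr1.
  rewrite linearZ /= -deriveE//; have [_ ->] := is_derive_flat_exp p t.
  by rewrite [v *: 1]mulr1.
by apply: Ck_onM; [exact: openT|exact: Ck_on_cst|exact: IH].
Qed.

Lemma smooth_affine1 (a c : R) : smooth_on setT (fun t : R => a * t + c).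
Proof.
apply: smooth_onD; [exact: openT| |exact: smooth_on_cst].
apply: smooth_onZ; first exact: openT.
by apply: (@smooth_on_lin _ _ _ _ (@idfun R)) => x.
Qed.

Definition smooth_step (t : R) : R := flat_exp 1 t / (flat_exp 1 t + flat_exp 1 (1 - t)).

Lemma flat_exp1E (t : R) : flat_exp 1 t = if 0 < t then expR (- t^-1) else 0.
Proof. by rewrite /flat_exp hornerC mul1r. Qed.

Lemma flat_exp1_ge0 (t : R) : 0 <= flat_exp 1 t.
Proof. by rewrite flat_exp1E; case: ifP => // _; rewrite expR_ge0. Qed.

Lemma step_den_gt0 (t : R) : 0 < flat_exp 1 t + flat_exp 1 (1 - t).
Proof.
have [t0|t0] := ltP 0 t.
  by rewrite ltr_wpDr ?flat_exp1_ge0// flat_exp1E t0 expR_gt0.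
by rewrite ltr_wpDl ?flat_exp1_ge0// flat_exp1E ifT ?expR_gt0// subr_gt0 (le_lt_trans t0).
Qed.

Lemma smooth_on_smooth_step : smooth_on setT smooth_step.
Proof.
have oT : open [set: R] by exact: openT.
have s1 : smooth_on setT (fun t : R => flat_exp 1 (1 - t)).
  apply: (smooth_on_comp1 (U' := setT)) => //; first exact: smooth_flat_exp.
  rewrite (_ : (fun t : R => 1 - t) = (fun t => -1 * t + 1)).
    exact: smooth_affine1.
  by apply/funext => t; ring.
apply: smooth_onM => //; first exact: smooth_flat_exp.
apply: smooth_onV => //; last by apply: smooth_onD => //; exact: smooth_flat_exp.
by move=> t _; rewrite gt_eqF// step_den_gt0.
Qed.

Lemma smooth_step0 (t : R) : t <= 0 -> smooth_step t = 0.
Proof. by move=> t0; rewrite /smooth_step flat_exp1E ltNge t0 mul0r. Qed.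

Lemma smooth_step1 (t : R) : 1 <= t -> smooth_step t = 1.
Proof.
move=> t1; rewrite /smooth_step [flat_exp 1 (1 - t)]flat_exp1E ltNge subr_le0 t1 /= addr0.
by rewrite divff// flat_exp1E (lt_le_trans ltr01 t1) expR_eq0.
Qed.

Lemma smooth_step_itv (t : R) : 0 <= smooth_step t <= 1.
Proof.
have d0 := step_den_gt0 t.
apply/andP; split; first by rewrite divr_ge0 ?flat_exp1_ge0 ?ltW.
by rewrite ler_pdivrMr// mul1r lerDl flat_exp1_ge0.
Qed.

(** Consecutive translates telescope, so the integer translates of this function
    form a partition of unity ([bump_partition]). *)
Definition bump (t : R) : R := smooth_step (t + 1) - smooth_step t.

Lemma smooth_on_bump : smooth_on setT bump.
Proof.
have oT : open [set: R] by exact: openT.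
apply: smooth_onB => //; last exact: smooth_on_smooth_step.
apply: (smooth_on_comp1 (U' := setT)) => //; first exact: smooth_on_smooth_step.
rewrite (_ : (fun t : R => t + 1) = (fun t => 1 * t + 1)).
  exact: smooth_affine1.
by apply/funext => t; ring.
Qed.

Lemma bump_out (t : R) : 1 <= `|t| -> bump t = 0.
Proof.
rewrite /bump ler_normr => /orP[t1|t1].
  by rewrite !smooth_step1 ?subrr// (le_trans t1)// lerDl.
by rewrite !smooth_step0 ?subrr//; lra.
Qed.

Lemma bump0 : bump 0 = 1.
Proof. by rewrite /bump add0r smooth_step1// smooth_step0// subr0. Qed.

Lemma bump_itv (t : R) : 0 <= bump t <= 1.
Proof.
rewrite /bump; have [t0|t0] := leP t 0.
  by rewrite (smooth_step0 t0) subr0 smooth_step_itv.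
have -> : smooth_step (t + 1) = 1 by rewrite smooth_step1//; lra.
by have /andP[s0 s1] := smooth_step_itv t; apply/andP; split; lra.
Qed.

Lemma bump_partition (t : R) (L : nat) : - L%:R <= t <= L%:R ->
  \sum_(i < (2 * L).+1) bump (t - (i%:R - L%:R)) = 1.
Proof.
move=> /andP[Lt tL].
rewrite -(big_mkord xpredT (fun i => bump (t - (i%:R - L%:R)))).
pose s (i : nat) := - smooth_step (t + 1 + L%:R - i%:R).
rewrite (eq_bigr (fun i => s i.+1 - s i)) => [|i _].
  rewrite telescope_sumr// /s.
  rewrite smooth_step0; last by rewrite -natr1 natrM; lra.
  by rewrite smooth_step1; lra.
by rewrite /s /bump opprK -natr1 [RHS]addrC; congr (smooth_step _ - smooth_step _); ring.
Qed.

(** The properties of [bump] that are inherited by its derivatives and that make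
    all of them bounded. *)
Definition bump_like (f : R -> R) :=
  smooth_on setT f /\ forall t, 1 < `|t| -> f t = 0.

Lemma bump_like_derive f : bump_like f -> bump_like ('D_(1 : R) f).
Proof.
move=> [sf f0]; split=> [|t t1]; first exact: smooth_on_derive.
rewrite -[RHS](derive_cst (0 : R) t (1 : R)); apply: near_eq_derive.
near=> s; rewrite f0//; near: s.
have cn : {for t, continuous (fun s : R => `|s|)} by exact: norm_continuous.
exact: (cn [set u | 1 < u] (lt_nbhsr t1)).
Unshelve. all: by end_near. Qed.

Lemma bump_like_bounded f : bump_like f -> exists2 B, 0 <= B & forall t, `|f t| <= B.
Proof.
move=> [sf f0].
have m11 : -1 <= 1 :> R by lra.
have cf : {within `[-1, 1], continuous (fun t : R => `|f t|)}.
  apply: continuous_subspaceT => t.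
  by apply: continuous_comp; [exact: (smooth_on_continuous sf)|exact: norm_continuous].
have [c _ fc] := EVT_max m11 cf.
exists `|f c| => // t; have [t1|t1] := leP `|t| 1.
  by apply: fc; rewrite in_itv/= -ler_norml.
by rewrite f0// normr0.
Qed.

(** Each differentiation of a function of [a * x 0 i + c] contributes a factor at
    most [a]. *)
Lemma bump_dbound f k : bump_like f -> exists2 B, 0 <= B &
  forall n i (a c : R), 1 <= a ->
    dbound k setT (fun x : 'rV[R]_n => f (a * x 0 i + c)) (a ^+ k * B).
Proof.
elim: k f => [|k IH] f bf; have [B0 B00 fB0] := bump_like_bounded bf.
  by exists B0 => // n i a c a1; split=> // x _; rewrite expr0 mul1r.
have [B1 B10 fB1] := IH _ (bump_like_derive bf).
exists (B0 + B1); first by rewrite addr_ge0.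
move=> n i a c a1; have a0 : 0 <= a by rewrite (le_trans _ a1).
have oT : open [set: 'rV[R]_n] by exact: openT.
pose l (x : 'rV[R]_n) := a * x 0 i + c.
have sl : smooth_on setT l.
  apply: smooth_onD => //; last exact: smooth_on_cst.
  by apply: smooth_onZ => //; exact: smooth_on_coord.
have sdf : smooth_on setT (fun x => 'D_(1 : R) f (l x)).
  exact: (smooth_on_comp1 oT (fun _ _ => I) (bump_like_derive bf).1 sl).
split=> [x _|j].
  rewrite (le_trans (fB0 _))// (@le_trans _ _ (1 * (B0 + B1)))//.
    by rewrite mul1r lerDl.
  by rewrite ler_wpM2r ?addr_ge0// exprn_ege1.
apply: (@dbound_eq _ _ _ _ _ (fun x => (a * (i == j)%:R) * 'D_(1 : R) f (l x))) => //.
  move=> x _; rewrite (@derive_comp1 _ _ f l); last 2 first.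
  - exact: (smooth_on_differentiable bf.1).
  - exact: (smooth_on_differentiable sl).
  rewrite mulrC; congr (_ * _).
  have dx := smooth_on_derivable (delta_mx 0 j) (@smooth_on_coord R n setT i) (x := x) I.
  rewrite /l (@deriveD _ _ _ (fun x : 'rV[R]_n => a * x 0 i) (cst c)); last 2 first.
  - exact: (@derivableZ _ _ _ _ a).
  - exact: derivable_cst.
  rewrite derive_cst addr0 (@deriveZ _ _ _ _ a)// derive_coord mxE eqxx /=.
  by rewrite eq_sym.
have hB := dboundZ (a * (i == j)%:R) oT sdf (fB1 n i a c a1).
apply: dbound_weaken hB.
rewrite exprS -mulrA normrM (ger0_norm a0) -mulrA ler_wpM2l//.
have : `|(i == j)%:R| <= 1 :> R by case: (i == j); rewrite ?normr0 ?normr1.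
move=> /(ler_wpM2r (mulr_ge0 (exprn_ge0 k a0) B10)) /le_trans; apply.
by rewrite mul1r ler_wpM2l ?exprn_ge0// lerDr.
Qed.

Lemma bump_like_bump : bump_like bump.
Proof. by split; [exact: smooth_on_bump|move=> t /ltW; exact: bump_out]. Qed.

End smooth_bumps.

(** * Cutoff functions with polynomial derivative bounds *)

Section cutoff.
Context {R : realType}.

Lemma norm_coord_le n (x : 'rV[R]_n) i : `|x 0 i| <= `|x|.
Proof. by rewrite [leRHS]mx_normrE; exact: (le_bigmax _ _ (0, i)). Qed.

Lemma norm_le_coord n (x : 'rV[R]_n) (e : R) : 0 <= e ->
  (forall i, `|x 0 i| <= e) -> `|x| <= e.
Proof.
move=> e0 xe; rewrite [leLHS]mx_normrE; apply: bigmax_le => // -[i j] _ /=.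
by rewrite ord1.
Qed.

Section cutoff_def.
Variables (n : nat) (K : set 'rV[R]_n) (L a : nat).
Let N := (2 * (L * a)).+1.

(** The multi-indices number the points of the lattice Z^n in the cube
    [-La, La]^n, shifted so that they start at 0. *)
Definition cell_offset (m : {ffun 'I_n -> 'I_N}) (i : 'I_n) : R :=
  (m i)%:R - (L * a)%:R.

Definition meets_cell (m : {ffun 'I_n -> 'I_N}) : bool :=
  `[< exists2 y, K y & forall i, `|a%:R * y 0 i - cell_offset m i| < 1 >].

(** The part of the partition of unity with cells of size 1/a that is carried by
    the lattice cells meeting [K]. *)
Definition cutoff (x : 'rV[R]_n) : R :=
  \sum_(m | meets_cell m) \prod_(i < n) bump (a%:R * x 0 i - cell_offset m i).

Let oT : open [set: 'rV[R]_n] := openT.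

Lemma smooth_on_cell_bump m i :
  smooth_on setT (fun x : 'rV[R]_n => bump (a%:R * x 0 i - cell_offset m i)).
Proof.
apply: (@smooth_on_comp1 _ _ _ setT (bump : R -> R)) => //; first exact: smooth_on_bump.
apply: smooth_onB => //; last exact: smooth_on_cst.
by apply: smooth_onZ => //; exact: smooth_on_coord.
Qed.

Lemma smooth_on_cutoff : smooth_on setT cutoff.
Proof.
apply: smooth_on_sum => // m _; apply: smooth_on_prod => // i _.
exact: smooth_on_cell_bump.
Qed.

Lemma cutoff1 (x : 'rV[R]_n) : (forall y i, K y -> `|y 0 i| <= L%:R) ->
  K x -> cutoff x = 1.
Proof.
move=> KL Kx.
have -> : cutoff x = \sum_m \prod_(i < n) bump (a%:R * x 0 i - cell_offset m i).
  rewrite /cutoff [RHS](bigID meets_cell)/= [X in _ = _ + X]big1 ?addr0// => m.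
  move=> /asboolPn mK; apply/eqP/negP => /negP p0; apply: mK; exists x => // i.
  rewrite ltNge; apply/negP => /bump_out b0.
  by move: p0; rewrite (bigD1 i)//= b0 mul0r eqxx.
rewrite -(bigA_distr_bigA (fun i (j : 'I_N) =>
  bump (a%:R * x 0 i - (j%:R - (L * a)%:R)))) big1// => i _.
apply: bump_partition.
have := KL x i Kx; rewrite ler_norml natrM => /andP[l1 l2].
have a0 : 0 <= a%:R :> R by [].
by apply/andP; split; nra.
Qed.

Lemma cutoff_neq0 (x : 'rV[R]_n) : (0 < a)%N -> cutoff x != 0 ->
  exists2 y, K y & `|x - y| <= 2 / a%:R.
Proof.
move=> a0 c0; have aR : 0 < a%:R :> R by rewrite ltr0n.
have [m [/asboolP[y Ky ym] p0]] : exists m, meets_cell m /\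
    \prod_(i < n) bump (a%:R * x 0 i - cell_offset m i) != 0.
  apply: contrapT => H; move: c0; rewrite /cutoff big1 ?eqxx// => m tm.
  by apply/eqP/negP => /negP p0; apply: H; exists m.
exists y => //; apply: norm_le_coord => [|i]; first by rewrite divr_ge0.
rewrite !mxE.
have xm : `|a%:R * x 0 i - cell_offset m i| < 1.
  rewrite ltNge; apply/negP => /bump_out b0.
  by move: p0; rewrite (bigD1 i)//= b0 mul0r eqxx.
rewrite ler_pdivlMr// -[X in _ * X]gtr0_norm// -normrM.
have -> : (x 0 i - y 0 i) * a%:R = (a%:R * x 0 i - cell_offset m i) - (a%:R * y 0 i - cell_offset m i).
  by ring.
rewrite (le_trans (ler_normB _ _))//.
by have := ym i; lra.
Qed.

End cutoff_def.

(** The number of cells and the derivatives of each term are bounded by powers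
    of [a]. *)
Lemma dbound_cutoff n (K : set 'rV[R]_n) L k : exists C (mu : nat),
  0 <= C /\ forall a, (0 < a)%N -> dbound k setT (cutoff K L a) (C * a%:R ^+ mu).
Proof.
have [B B0 fB] := bump_dbound k (@bump_like_bump R).
exists (((2 * L%:R + 1) * (2 ^+ k * B)) ^+ n), (n * k.+1)%N.
split; first by rewrite exprn_ge0// !mulr_ge0 ?addr_ge0 ?mulr_ge0 ?exprn_ge0.
move=> a a0.
have a1 : 1 <= a%:R :> R by rewrite ler1n.
have ak0 : 0 <= a%:R ^+ k :> R by rewrite exprn_ge0.
have oT : open [set: 'rV[R]_n] := openT.
pose M : R := (2 ^+ k * (a%:R ^+ k * B)) ^+ n.
have M0 : 0 <= M by rewrite exprn_ge0// !mulr_ge0// exprn_ge0.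
have hM (m : {ffun 'I_n -> 'I_(2 * (L * a)).+1}) : dbound k setT
    (fun x : 'rV[R]_n => \prod_(i < n) bump (a%:R * x 0 i - cell_offset m i)) M.
  rewrite /M -[n in _ ^+ n]card_ord cardE enumT.
  apply: dbound_prod => //; first by rewrite mulr_ge0.
    by move=> i; exact: smooth_on_cell_bump.
  by move=> i; exact: fB.
have := @dbound_sum R n k setT _ (index_enum _) (meets_cell K (L:=L) (a:=a))
  (fun m x => \prod_(i < n) bump (a%:R * x 0 i - cell_offset m i)) M oT M0
  (fun m _ => smooth_on_prod (index_enum _) oT (fun i _ => smooth_on_cell_bump m i))
  (fun m _ => hM m).
apply: dbound_weaken.
rewrite [index_enum _]unlock -enumT -cardE card_ffun !card_ord natrX /M (mulnC n) exprM -!exprMn.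
rewrite lerXn2r ?nnegrE ?mulr_ge0 ?addr_ge0 ?mulr_ge0 ?exprn_ge0//.
rewrite exprS.
have -> : (2 * L%:R + 1) * (2 ^+ k * B) * (a%:R * a%:R ^+ k) =
  ((2 * L%:R + 1) * a%:R) * (2 ^+ k * (a%:R ^+ k * B)) :> R by ring.
rewrite ler_wpM2r ?mulr_ge0 ?exprn_ge0// -natr1 !natrM; lra.
Qed.

End cutoff.

(** * Extension from the interior of a convex body *)

Section extension.
Context {R : realType}.

Lemma smooth_on_near (V W : normedModType R) (U : set V) (f : V -> W) :
  (forall x, U x -> exists A g, [/\ open A, A x, forall y, A y -> f y = g y
     & smooth_on A g]) -> smooth_on U f.
Proof.
move=> h k; apply: Ck_on_near => x /h[A [g [oA Ax fg sg]]]; exists A, g.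
by split=> // y; rewrite inE; exact: fg.
Qed.

Definition segment_convex n (K : set 'rV[R]_n) :=
  forall x y t, K x -> K y -> 0 <= t <= 1 -> K (x + t *: (y - x)).

Section construction.
Variables (n : nat) (K : set 'rV[R]_n) (b : 'rV[R]_n) (r : R) (L : nat).
Hypothesis cK : segment_convex K.
Hypothesis r0 : 0 < r.
Hypothesis bK : forall x, `|x - b| < r -> K x.
Hypothesis KL : forall x, K x -> `|x| <= L%:R.

Let U := interior K.
Let oU : open U := @open_interior _ K.

(** If the ball of radius [r] about [b] lies in [K], then [K] contains the ball
    of radius (1 - q) r about the image of any of its points under the homothety
    of ratio [q] centred at [b]: it consists of convex combinations. *)
Lemma interior_dil y z (q : R) : K y -> 0 <= q < 1 ->
  `|z - dil b q y| < (1 - q) * r -> U z.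
Proof.
move=> Ky /andP[q0 q1] zq.
suff h w : `|w - dil b q y| < (1 - q) * r -> K w.
  rewrite /U /interior /=; apply/nbhs_ballP.
  exists ((1 - q) * r - `|z - dil b q y|); first by rewrite /= subr_gt0.
  move=> w; rewrite -ball_normE /= => zw; apply: h.
  rewrite -(subrK z w) -addrA (le_lt_trans (ler_normD _ _))//.
  by rewrite distrC -ltrBrDr.
move=> wq; have q1' : 0 < 1 - q by rewrite subr_gt0.
pose v := b + (1 - q)^-1 *: (w - dil b q y).
have Kv : K v.
  apply: bK; rewrite /v addrAC subrr add0r normrZ gtr0_norm ?invr_gt0//.
  by rewrite ltr_pdivrMl.
have -> : w = v + q *: (y - v).
  apply/rowP => i; rewrite !mxE; field; lra.
by apply: cK => //; rewrite q0 ltW.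
Qed.

Lemma interior_center : U b.
Proof.
have Kb : K b by apply: bK; rewrite subrr normr0.
apply: (@interior_dil b _ 0) => //; first by rewrite lexx ltr01.
by rewrite /dil scale0r addr0 subrr normr0 subr0 mul1r.
Qed.

Lemma interior_star x t : U x -> 0 <= t <= 1 -> U (dil b t x).
Proof.
move=> Ux /andP[t0]; rewrite le_eqVlt => /predU1P[->|t1].
  by rewrite /dil scale1r addrC subrK.
apply: (@interior_dil x _ t); [exact: interior_subset|by rewrite t0|].
by rewrite subrr normr0 mulr_gt0// subr_gt0.
Qed.

Lemma interior_dist x : U x -> `|x - b| <= 2 * L%:R.
Proof.
move=> /interior_subset Kx; rewrite (le_trans (ler_normB _ _))// mulr_natl mulr2n.
by rewrite lerD ?KL//; apply: interior_subset; exact: interior_center.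
Qed.

Definition ratio (k : nat) : R := 1 - (2 ^+ k)^-1.

Lemma ratio_itv k : 0 <= ratio k <= 1.
Proof.
rewrite /ratio subr_ge0 gerBl invr_ge0 exprn_ge0// andbT.
by rewrite invf_le1 ?exprn_gt0// exprn_ege1// ler1n.
Qed.

Variable f : 'rV[R]_n -> R.
Hypothesis sf : smooth_on U f.
Hypothesis df : forall k, exists M, dbound k U f M.

(** The remainders of the expansion of [f] as the sum of the functions
    [remainder k (dil b (ratio k.+1) x)]. *)
Fixpoint remainder (k : nat) : 'rV[R]_n -> R :=
  if k is j.+1 then fun x => remainder j x - remainder j (dil b (ratio j.+1) x)
  else f.

Let Udil q : 0 <= q <= 1 -> forall x, U x -> U (dil b q x).
Proof. by move=> q01 x Ux; exact: interior_star. Qed.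

Lemma smooth_on_remainder k : smooth_on U (remainder k).
Proof.
elim: k => [|k IH]; first exact: sf.
apply: smooth_onB => //.
by apply: (smooth_on_dil (U := U)) => //; exact/Udil/ratio_itv.
Qed.

(** Induction on [m].  For m = 0 every step doubles the bound at most.  The bound
    for m + 1 at index j + 1 follows from the one for [m] at index j and one more
    derivative, since the last step gains the factor 1 - q = 2^-(j+1). *)
Lemma remainder_bound m k : exists2 C, 0 <= C &
  forall j, dbound k U (remainder j) (C * 2 ^+ j / (2 ^+ j) ^+ m).
Proof.
elim: m k => [|m IH] k.
  have [M fM] := df k.
  exists M; first exact: (dbound_ge0 fM interior_center).
  elim=> [|j IH]; first by rewrite !expr0 mulr1 divr1.
  have := dbound_sub_dil oU (Udil (ratio_itv j.+1)) (ratio_itv j.+1)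
    (smooth_on_remainder j) IH.
  by rewrite !expr0 !divr1 [2 ^+ j.+1]exprS mulrCA.
have [C0 fC0] := df k; have C00 := dbound_ge0 fC0 interior_center.
have [C1 C10 hC1] := IH k.+1.
pose A : R := n%:R * (2 * L%:R) + 0 + k%:R.
have A0 : 0 <= A by rewrite !addr_ge0// !mulr_ge0.
(* [C0] takes care of the index 0, the other term of the induction step. *)
exists (C0 + A * C1 * 2 ^+ m).
  by rewrite addr_ge0// !mulr_ge0// exprn_ge0.
case=> [|j].
  apply: dbound_weaken fC0; rewrite expr0 expr1n mulr1 divr1 lerDl.
  by rewrite !mulr_ge0// exprn_ge0.
have := @dbound_sub_dil_small R n k U (remainder j) b (ratio j.+1) 1 (2 * L%:R) 0 _
  oU interior_star interior_dist (ratio_itv j.+1).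
rewrite ler01 lexx subrr mul0r => /(_ _ isT (lexx 0) (smooth_on_remainder j) (hC1 j)).
rewrite (_ : (fun x => remainder j x - 1 * remainder j (dil b (ratio j.+1) x)) =
  remainder j.+1); last by apply/funext => x; rewrite mul1r.
apply: dbound_weaken; rewrite -/A.
have -> : 1 - ratio j.+1 = (2 ^+ j.+1)^-1 by rewrite /ratio opprB addrCA subrr addr0.
rewrite !exprS !exprMn; set P : R := 2 ^+ j; set Q := P ^+ m.
have P0 : 0 < P by rewrite exprn_gt0.
have Q0 : 0 < Q by rewrite exprn_gt0.
have m0 : 0 < 2 ^+ m :> R by rewrite exprn_gt0.
have -> : (C0 + A * C1 * 2 ^+ m) * (2 * P) / (2 * P * (2 ^+ m * Q)) =
    C0 / (2 ^+ m * Q) + A * C1 / Q.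
  by field; rewrite !gt_eqF.
have -> : A / (2 * P) * (C1 * P / Q) = A * C1 / Q / 2.
  by field; rewrite !gt_eqF.
rewrite ler_wpDl//; first by rewrite divr_ge0// mulr_ge0// ltW.
by rewrite ler_pdivrMr// ler_peMr ?ler1n// divr_ge0 ?mulr_ge0// ltW.
Qed.

Variable a : nat.
Hypothesis a0 : (0 < a)%N.
Hypothesis ar : 6 <= a%:R * r.

Let resolution k := (a * 2 ^ k)%N.

Let resolution_gt0 k : (0 < resolution k)%N.
Proof. by rewrite muln_gt0 a0 expn_gt0. Qed.

Let W k := [set x | U (dil b (ratio k.+1) x)].

Lemma open_scaled k : open (W k).
Proof. by apply: (@open_comp _ _ (dil b (ratio k.+1)) U) => // x _; exact: continuous_dil. Qed.

(** A point outside the domain of the k-th term has distance at least three cell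
    sizes from [K], whereas the cutoff lives within two cell sizes of [K]. *)
Lemma cutoff_support k x : ~ W k x ->
  forall y, `|x - y| < (resolution k)%:R^-1 -> cutoff K L (resolution k) y = 0.
Proof.
move=> nWx y xy; apply/eqP/negPn/negP => /(cutoff_neq0 (resolution_gt0 k))[z Kz yz].
apply: nWx; have [q0 q1] := andP (ratio_itv k.+1).
have s0 : 1 - ratio k.+1 = (2 ^+ k.+1)^-1 by rewrite /ratio opprB addrCA subrr addr0.
have s0' : 0 < 1 - ratio k.+1 by rewrite s0 invr_gt0 exprn_gt0.
apply: (interior_dil Kz (q := ratio k.+1)); first by rewrite q0 -subr_gt0.
have -> : dil b (ratio k.+1) x - dil b (ratio k.+1) z = ratio k.+1 *: (x - z).
  by apply/rowP => i; rewrite !mxE; ring.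
rewrite normrZ ger0_norm// (@le_lt_trans _ _ `|x - z|)//; first by rewrite ler_piMl.
rewrite -(subrK y x) -addrA (le_lt_trans (ler_normD _ _))//.
rewrite (@lt_le_trans _ _ (3 / (resolution k)%:R))//; first by lra.
have m0 : 0 < (resolution k)%:R :> R by rewrite ltr0n.
rewrite ler_pdivrMr// s0 /resolution natrM natrX exprS.
have P0 : 0 < 2 ^+ k :> R by rewrite exprn_gt0.
have -> : (2 * 2 ^+ k)^-1 * r * (a%:R * 2 ^+ k) = (a%:R * r) / 2.
  by field; rewrite gt_eqF.
by rewrite ler_pdivlMr// (_ : 3 * 2 = 6) //; ring.
Qed.

Definition piece k (x : 'rV[R]_n) : R :=
  cutoff K L (resolution k) x * remainder k (dil b (ratio k.+1) x).

Let piece_local k x : exists A g, [/\ open A, A x, forall y, A y -> piece k y = g y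
  & (A = W k /\ g = piece k) \/ g = fun=> 0].
Proof.
have [Wx|nWx] := pselect (W k x).
  exists (W k), (piece k); split=> //; [exact: open_scaled|by left].
exists (ball x (resolution k)%:R^-1), (fun=> 0); split=> //.
- exact: ball_open.
- by apply: ballxx; rewrite invr_gt0 ltr0n.
- move=> y; rewrite -ball_normE /= => xy.
  by rewrite /piece (cutoff_support nWx xy) mul0r.
- by right.
Qed.

Let smooth_scaled k : smooth_on (W k) (fun x => remainder k (dil b (ratio k.+1) x)).
Proof.
apply: (smooth_on_dil (U := U)) => //; first exact: open_scaled.
exact: smooth_on_remainder.
Qed.

Lemma smooth_on_piece k : smooth_on setT (piece k).
Proof.
apply: smooth_on_near => x _; have [A [g [oA Ax fg h]]] := piece_local k x.
exists A, g; split=> //; case: h => [[-> ->]|->]; last exact: smooth_on_cst.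
apply: smooth_onM => //; first exact: open_scaled.
by apply: smooth_onS (@smooth_on_cutoff _ _ _ _ _).
Qed.

Lemma dbound_piece k : exists C, forall j, dbound k setT (piece j) (C / 2 ^+ j).
Proof.
have [C1 [mu [C10 hC1]]] := @dbound_cutoff R n K L k.
have [C2 C20 hC2] := remainder_bound mu.+2 k.
(* The power [mu] of the resolution lost in the cutoff is compensated by using the
   decay of the remainder to order [mu + 2]. *)
exists (2 ^+ k * (C1 * a%:R ^+ mu * C2)) => j.
apply: dbound_local => x _; have [A [g [oA Ax fg h]]] := piece_local j x.
exists A, g; split=> //; case: h => [[-> ->]|->]; last first.
  by apply: dbound0; rewrite divr_ge0 ?exprn_ge0// !mulr_ge0 ?exprn_ge0.
have oW := @open_scaled j.
have b1 : dbound k (W j) (cutoff K L (resolution j)) (C1 * (resolution j)%:R ^+ mu).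
  by apply: dboundW (hC1 _ (resolution_gt0 j)).
have b2 := dbound_dil oW (U := U) (fun x h => h) (ratio_itv j.+1)
  (smooth_on_remainder j) (hC2 j).
have sc : smooth_on (W j) (cutoff K L (resolution j)).
  by apply: smooth_onS (@smooth_on_cutoff _ _ _ _ _).
apply: dbound_weaken (dboundM oW sc (smooth_scaled j) b1 b2).
rewrite /resolution natrM natrX exprMn; set P : R := 2 ^+ j.
have P0 : 0 < P by rewrite exprn_gt0.
have Q0 : 0 < P ^+ mu by rewrite exprn_gt0.
rewrite [P ^+ mu.+2]exprS [P ^+ mu.+1]exprS.
by rewrite le_eqVlt; apply/orP; left; apply/eqP; field; rewrite !gt_eqF.
Qed.

Lemma fast_piece : fast_series piece.
Proof. by split; [exact: smooth_on_piece|exact: dbound_piece]. Qed.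

(** In the interior of [K] the cutoffs are 1, and the partial sums telescope to
    [f x - remainder J x]. *)
Lemma sum_piece x : U x -> sum_series piece x = f x.
Proof.
move=> Ux; have Kx := interior_subset Ux.
have KL' y i : K y -> `|y 0 i| <= L%:R.
  by move=> /KL; apply: le_trans; exact: norm_coord_le.
have sE J : series (piece ^~ x) J = f x - remainder J x.
  elim: J => [|J IH]; first by rewrite /series /= big_geq// subrr.
  rewrite /series /= big_nat_recr//= -[X in X + _]/(series (piece ^~ x) J) IH.
  by rewrite /piece cutoff1// mul1r; ring.
have [C C0 hC] := remainder_bound 2 0.
have r_0 : (fun J => remainder J x) @ \oo --> (0 : R).
  apply/norm_cvg0P.
  apply: (@squeeze_cvgr _ _ _ _ (fun=> 0) (fun J => C * 2^-1 ^+ J)).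
  - near=> J; rewrite normr_ge0/= (le_trans (dbound_le (hC J) Ux))//.
    rewrite exprVn expr2 le_eqVlt; apply/orP; left; apply/eqP; field.
    by rewrite expf_neq0.
  - exact: cvg_cst.
  - rewrite -[X in _ --> X](mulr0 C); apply: cvgM; first exact: cvg_cst.
    by apply: cvg_expr; rewrite ger0_norm// invf_lt1// ltr1n.
apply: cvg_lim => //; rewrite (_ : series _ = fun J => f x - remainder J x).
  by rewrite -[X in _ --> X]subr0; apply: cvgB => //; exact: cvg_cst.
exact/funext.
Unshelve. all: by end_near. Qed.

End construction.

(** A Whitney extension theorem for convex bodies.  Boundedness of the derivatives
    replaces boundary data: by convexity it makes all derivatives Lipschitz. *)
Theorem extension_bounded_derivs n (K : set 'rV[R]_n) b r L f :
  segment_convex K -> 0 < r -> (forall x, `|x - b| < r -> K x) ->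
  (forall x, K x -> `|x| <= L) ->
  smooth_on (interior K) f -> (forall k, exists M, dbound k (interior K) f M) ->
  exists2 F, smooth_on setT F & forall x, interior K x -> F x = f x.
Proof.
move=> cK r0 bK KL sf df.
(* The cells have size 2^-k / a; by the choice of [a], three cell sizes are at
   most 2^-(k+1) r. *)
pose N := (Num.truncn `|L|).+1; pose a := (Num.truncn (6 / r)).+1.
have KN x : K x -> `|x| <= N%:R.
  move=> /KL xL; rewrite (le_trans xL)// (le_trans (ler_norm _))// ltW//.
  by rewrite truncnS_gt.
have ar : 6 <= a%:R * r by rewrite -ler_pdivrMr// ltW// truncnS_gt.
exists (sum_series (piece K b N f a)).
  exact/smooth_sum_series/(fast_piece cK r0 bK KN sf df).
by move=> x Kx; apply: (sum_piece cK r0 bK KN).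
Qed.

End extension.

(** * Functions smooth along plots are bounded *)

Section plot_smooth.
Context {R : realType}.

(** Total functions are used; on a set [K] only the values on [K] matter. *)
Definition plot_smooth n (K : set 'rV[R]_n) (f : 'rV[R]_n -> R) : Prop :=
  forall d (U : set 'rV[R]_d) (p : 'rV[R]_d -> 'rV[R]_n), open U ->
    (forall i, smooth_on U (fun x => p x 0 i)) -> (forall x, U x -> K (p x)) ->
    smooth_on U (fun x => f (p x)).

Lemma plot_smooth_interior n (K : set 'rV[R]_n) f : plot_smooth K f ->
  smooth_on (interior K) f.
Proof.
move=> Kf; apply: (Kf n (interior K) id); first exact: open_interior.
  by move=> i; exact: smooth_on_coord.
by move=> x; exact: interior_subset.
Qed.

Lemma plot_smooth_comb n (K : set 'rV[R]_n) f g c : plot_smooth K f -> plot_smooth K g ->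
  plot_smooth K (fun x => c * (f x - g x)).
Proof.
move=> Kf Kg d U p oU sp pK; apply: smooth_onZ => //.
by apply: smooth_onB => //; [exact: Kf|exact: Kg].
Qed.

Lemma cvg_half_powers (k : 'rV[R]_1 -> R) : {for 0, continuous k} ->
  (fun j => k (const_mx (2^-1 ^+ j))) @ \oo --> k 0.
Proof.
move=> ck; apply: (@cvg_comp _ _ _ (fun j => const_mx (2^-1 ^+ j)) k _ _ _ _ ck).
apply/cvgrPdist_lt => e e0.
have : (fun j => 2^-1 ^+ j : R) @ \oo --> (0 : R).
  by apply: cvg_expr; rewrite ger0_norm// invf_lt1// ltr1n.
move/cvgrPdist_lt => /(_ _ e0); apply: filterS => j; rewrite !sub0r !normrN => h.
rewrite (le_lt_trans _ h)//; apply: norm_le_coord => // i.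
by rewrite mxE.
Qed.

(** The coefficient and the shift place the bump at s = 2^-j, with a support of
    radius 2^-(j+2), so that the supports for different [j] are disjoint. *)
Definition dyadic_bump (j : nat) (s : 'rV[R]_1) : R := bump (2 ^+ j.+2 * s 0 0 + - 4).

Lemma dyadic_bump_disjoint i j s : (i < j)%N -> dyadic_bump i s != 0 -> dyadic_bump j s = 0.
Proof.
move=> ij; rewrite /dyadic_bump => wi; apply: bump_out.
have {wi} : `|2 ^+ i.+2 * s 0 0 + - 4| < 1.
  by rewrite ltNge; apply/negP => /bump_out b0; rewrite b0 eqxx in wi.
rewrite ltr_norml => /andP[h1 h2].
have -> : 2 ^+ j.+2 * s 0 0 = 2 ^+ (j - i) * (2 ^+ i.+2 * s 0 0).
  by rewrite mulrA -exprD; congr (2 ^+ _ * _); lia.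
have : 2 <= 2 ^+ (j - i) :> R.
  by rewrite -[leLHS]expr1 ler_eXn2l ?ltr1n// subn_gt0.
set u := 2 ^+ (j - i); set v := 2 ^+ i.+2 * s 0 0 in h1 h2 * => u2.
rewrite ler_normr; apply/orP; left; nra.
Qed.

Lemma dyadic_bump_at j : dyadic_bump j (const_mx (2^-1 ^+ j)) = 1.
Proof.
rewrite /dyadic_bump mxE exprVn -[j.+2]addn2 exprD mulrAC divff ?expf_neq0// mul1r.
by rewrite (_ : 2 ^+ 2 + -4 = 0) ?bump0//; ring.
Qed.

Lemma pow2_fast (j k : nat) :
  (2 ^+ j) ^+ k / (2 ^+ j) ^+ j <= (2 ^+ k.+1) ^+ k.+1 / 2 ^+ j :> R.
Proof.
have p2 (m : nat) : 0 < 2 ^+ m :> R by rewrite exprn_gt0.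
have p2' (m l : nat) : 0 < (2 ^+ m) ^+ l :> R by rewrite exprn_gt0.
rewrite ler_pdivlMr// mulrAC ler_pdivrMr// -exprSr -!exprM -exprD.
rewrite ler_weXn2l ?ler1n//; nia.
Qed.

(** The k-th derivatives grow like (2^j)^k, which coefficients of size 2^-(j^2)
    outweigh for every [k] ([pow2_fast]). *)
Lemma fast_dyadic_bump (y : nat -> R) : (forall j, `|y j| <= ((2 ^+ j) ^+ j)^-1) ->
  fast_series (fun j s => y j * dyadic_bump j s).
Proof.
move=> yj; have oT : open [set: 'rV[R]_1] := openT.
have sw j : smooth_on setT (dyadic_bump j).
  apply: (smooth_on_comp1 (U' := setT)) => //; first exact: smooth_on_bump.
  apply: smooth_onD => //; last exact: smooth_on_cst.
  by apply: smooth_onZ => //; exact: smooth_on_coord.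
split=> [j|k]; first exact: smooth_onZ.
have [B B0 fB] := bump_dbound k (@bump_like_bump R).
exists ((2 ^+ 2) ^+ k * B * (2 ^+ k.+1) ^+ k.+1) => j.
have a1 : 1 <= 2 ^+ j.+2 :> R by rewrite exprn_ege1// ler1n.
apply: dbound_weaken (dboundZ (y j) oT (sw j) (fB 1%N 0 _ (-4) a1)).
have -> : (2 ^+ j.+2) ^+ k = (2 ^+ 2) ^+ k * (2 ^+ j) ^+ k :> R.
  by rewrite -exprMn -exprD; congr ((2 ^+ _) ^+ _); lia.
rewrite mulrC (le_trans (ler_wpM2l _ (yj j)))//.
  by rewrite !mulr_ge0// exprn_ge0.
have -> : (2 ^+ 2) ^+ k * (2 ^+ j) ^+ k * B / (2 ^+ j) ^+ j =
   (2 ^+ 2) ^+ k * B * ((2 ^+ j) ^+ k / (2 ^+ j) ^+ j) :> R by ring.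
rewrite -[leRHS]mulrA ler_wpM2l ?pow2_fast// mulr_ge0// exprn_ge0//.
Qed.

Lemma sum_series_single n (h : nat -> 'rV[R]_n -> R) j x :
  (forall i, i != j -> h i x = 0) -> sum_series h x = h j x.
Proof.
move=> h0; apply: cvg_lim => //; apply: cvg_near_cst; exists j.+1 => // J /= jJ.
rewrite /series /= (bigD1_seq j) ?iota_uniq//=; last by rewrite mem_index_iota.
by rewrite big1 ?addr0.
Qed.

(** A sequence along which |f| tends to infinity has a cluster point by
    compactness. *)
Lemma compact_unbounded n (K : set 'rV[R]_n) (f : 'rV[R]_n -> R) : compact K ->
  ~ (exists M, forall x, K x -> `|f x| <= M) ->
  exists2 x, K x & forall (e M : R), 0 < e ->
    exists y, [/\ K y, `|y - x| < e & M < `|f y|].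
Proof.
move=> cK nb.
have /choice[u uP] : forall j : nat, exists x, K x /\ j%:R < `|f x|.
  move=> j; apply: contrapT => H; apply: nb; exists j%:R => x Kx.
  by rewrite leNgt; apply/negP => fx; apply: H; exists x.
have FK : (u @ \oo) K by exists 0%N => // j _; exact: (uP j).1.
have [x [Kx xu]] := cK (u @ \oo) _ FK.
exists x => // e M e0.
have [|y [[j Jj <-] xy]] :=
  xu [set u j | j in [set j | ((Num.truncn `|M|).+1 <= j)%N]] (ball x e) _ (nbhsx_ballx _ _ e0).
  by exists (Num.truncn `|M|).+1 => // j /= Jj; exists j.
exists (u j); split; first exact: (uP j).1.
  by rewrite distrC; move: xy; rewrite -ball_normE.
rewrite (le_lt_trans (ler_norm _))// (lt_trans _ (uP j).2)//.
by rewrite (lt_le_trans (truncnS_gt _))// ler_nat.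
Qed.

Lemma cvg_le_index (u : nat -> R) (l : R) : u @ \oo --> l ->
  exists j, `|u j| <= j%:R.
Proof.
move=> /cvgrPdist_lt /(_ 1 ltr01) [N _ uN].
pose J := (N + (Num.truncn (`|l| + 1)%R).+1)%N.
exists J; have NJ : (N <= J)%N by exact: leq_addr.
have lJ : (`|l| + 1 <= J%:R)%R.
  by rewrite ltW// (lt_le_trans (truncnS_gt _))// ler_nat leq_addl.
rewrite (le_trans _ lJ)// -[u J](subKr l).
by rewrite (le_trans (ler_normB _ _))// lerD2l ltW//; exact: uN.
Qed.

(** If [f] is unbounded near x, choose points y_j at distance less than 2^-(j^2)
    of x with |f(y_j)| > j.  The curve x + sum_j phi_j(s) (y_j - x), with disjoint
    bumps phi_j equal to 1 at 2^-j, is smooth, lies in [K] by convexity, and runs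
    through y_j at time 2^-j; but f is continuous along it at 0. *)
Lemma plot_smooth_bounded n (K : set 'rV[R]_n) f : compact K -> segment_convex K ->
  plot_smooth K f -> exists M, forall x, K x -> `|f x| <= M.
Proof.
move=> cK sK Kf; apply: contrapT => /(compact_unbounded cK)[x Kx xf].
have /choice[y yP] : forall j : nat, exists y,
    [/\ K y, `|y - x| < ((2 ^+ j) ^+ j)^-1 & j%:R < `|f y|].
  by move=> j; apply: xf; rewrite invr_gt0 !exprn_gt0.
pose h i j (s : 'rV[R]_1) := (y j - x) 0 i * dyadic_bump j s.
have fh i : fast_series (h i).
  apply: fast_dyadic_bump => j; have [_ yx _] := yP j.
  by rewrite (le_trans (norm_coord_le _ _))// ltW.
pose c (s : 'rV[R]_1) := x + \row_i sum_series (h i) s.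
have cE s j : (forall i, i != j -> dyadic_bump i s = 0) -> c s = x + dyadic_bump j s *: (y j - x).
  move=> w0; congr (_ + _); apply/rowP => i; rewrite mxE (sum_series_single (j := j)).
    by rewrite /h mulrC !mxE.
  by move=> k kj; rewrite /h w0// mulr0.
have cK' s : K (c s).
  have [[j wj]|w0] := pselect (exists j, dyadic_bump j s != 0).
    have [Ky _ _] := yP j; rewrite (cE s j).
      by apply: sK => //; exact: bump_itv.
    move=> i ij; apply/eqP/negPn/negP => wi.
    have [ij'|ji|ij'] := ltngtP i j; last by rewrite ij' eqxx in ij.
      by rewrite (dyadic_bump_disjoint ij' wi) eqxx in wj.
    by rewrite (dyadic_bump_disjoint ji wj) eqxx in wi.
  have w00 j : dyadic_bump j s = 0 by apply/eqP/negPn/negP => wj; apply: w0; exists j.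
  by rewrite (cE s 0%N) ?w00 ?scale0r ?addr0// => i _; exact: w00.
have c_at j : c (const_mx (2^-1 ^+ j)) = y j.
  rewrite (cE _ j) ?dyadic_bump_at ?scale1r ?subrKC//.
  move=> i ij; apply/eqP/negPn/negP => wi.
  have w1 := dyadic_bump_at j.
  have [ij'|ji|ij'] := ltngtP i j; last by rewrite ij' eqxx in ij.
    by move: w1; rewrite (dyadic_bump_disjoint ij' wi) => /eqP; rewrite eq_sym oner_eq0.
  by move/eqP: wi; apply; apply: (dyadic_bump_disjoint ji); rewrite w1 oner_eq0.
have sfc : smooth_on setT (fun s => f (c s)).
  apply: Kf; [exact: openT| |by move=> s _; exact: cK'].
  move=> i; rewrite (_ : (fun s => c s 0 i) = fun s => x 0 i + sum_series (h i) s).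
    apply: smooth_onD; [exact: openT|exact: smooth_on_cst|exact: smooth_sum_series].
  by apply/funext => s; rewrite !mxE.
have := cvg_half_powers (smooth_on_continuous sfc (x := 0) I).
move=> /cvg_le_index[J]; rewrite c_at leNgt => /negP; apply.
by have [] := yP J.
Qed.

End plot_smooth.

(** * Derivatives up to the boundary *)

Section one_sided_derivative.
Context {R : realType}.

Lemma continuous_lsub d : continuous (fun z : 'rV[R]_(d + 1) => lsubmx z).
Proof. by move=> z; apply: differentiable_continuous; exact: differentiable_lsubmx. Qed.

(** A curve that leaves [y] towards [c] in both directions of the parameter, so
    that it is a plot of [K] around 0 even when [y] is a boundary point. *)
Definition square_curve n (c y : 'rV[R]_n) (s : R) : 'rV[R]_n := y + s ^+ 2 *: (c - y).

(** With g(t) = f(y + t (c - y)) this is half the second derivative of g(s^2) at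
    0, that is, the one-sided derivative g'(0). *)
Definition curve_derive n (c : 'rV[R]_n) (f : 'rV[R]_n -> R) (y : 'rV[R]_n) : R :=
  2^-1 * 'D_(1 : R) ('D_(1 : R) (fun s => f (square_curve c y s))) 0.

(** Adding the curve parameter as a last coordinate to a plot p gives another
    plot; twice differentiating f along it in the new direction and restricting
    to s = 0 computes the function along p. *)
Lemma plot_smooth_curve_derive n (K : set 'rV[R]_n) f c : segment_convex K -> K c ->
  plot_smooth K f -> plot_smooth K (curve_derive c f).
Proof.
move=> sK Kc Kf d U p oU sp pK.
pose t (z : 'rV[R]_(d + 1)) := z 0 (rshift d ord0).
pose q (z : 'rV[R]_(d + 1)) := square_curve c (p (lsubmx z)) (t z).
pose V := (fun z : 'rV[R]_(d + 1) => lsubmx z) @^-1` U `&` [set z | `|t z| < 1].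
have oV : open V.
  apply: openI; first by apply: open_comp => // z _; exact: continuous_lsub.
  apply: (@open_comp _ _ (fun z => `|t z|) [set r : R | r < 1]).
    move=> z _; apply: continuous_comp; first exact: coord_continuous.
    exact: norm_continuous.
  exact: open_lt.
have st : smooth_on V t by exact: smooth_on_coord.
have sl i : smooth_on V (fun z => p (lsubmx z) 0 i).
  apply: (@smooth_on_comp_row _ _ _ V U (fun x => p x 0 i) (fun z => lsubmx z)) => //.
    by move=> z [].
  move=> j; under eq_fun do rewrite mxE; exact: smooth_on_coord.
have sg : smooth_on V (fun z => f (q z)).
  apply: Kf => //.
    move=> i; rewrite (_ : (fun z => q z 0 i) = fun z => p (lsubmx z) 0 i +
        (t z * t z) * (c 0 i - p (lsubmx z) 0 i)).
      apply: smooth_onD => //; apply: smooth_onM => //; first exact: smooth_onM.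
      by apply: smooth_onB => //; exact: smooth_on_cst.
    by apply/funext => z; rewrite !mxE expr2.
  move=> z [Uz tz]; apply: sK => //; first exact: pK.
  rewrite sqr_ge0/= -real_normK ?num_real// expr_le1// ltW//.
pose e : 'rV[R]_(d + 1) := delta_mx 0 (rshift d ord0).
pose g2 := 'D_e ('D_e (fun z => f (q z))).
have sg2 : smooth_on V g2 by do 2!apply: smooth_on_derive.
have E x : curve_derive c f (p x) = 2^-1 * g2 (row_mx x 0).
  have lE s : (fun s => f (square_curve c (p x) s)) s = f (q (row_mx x 0 + s *: e)).
    rewrite /q; congr (f (square_curve _ (p _) _)).
      apply/rowP => i; by rewrite !mxE (unsplitK (inl i)) eq_lrshift andbF mulr0 addr0.
    by rewrite /t !mxE (unsplitK (inr ord0)) mxE !eqxx mulr1 add0r.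
  rewrite /curve_derive (funext lE).
  have -> : 'D_(1 : R) (fun s : R => f (q (row_mx x 0 + s *: e))) =
      (fun s : R => 'D_e (fun z => f (q z)) (row_mx x 0 + s *: e)).
    by apply/funext => s; exact: (derive_line (fun z => f (q z))).
  by rewrite (derive_line ('D_e (fun z => f (q z)))) scale0r addr0.
clearbody g2; under eq_fun do rewrite E.
apply: (smooth_onZ _ oU).
apply: (@smooth_on_comp_row _ _ _ U V g2 (fun x => row_mx x 0)) => //.
  move=> x Ux; split; first by rewrite /= row_mxKl.
  by rewrite /t /= mxE (unsplitK (inr ord0)) mxE normr0.
move=> j; case: (splitP j) => [i ji|i ji].
  have -> : j = lshift 1 i by exact: val_inj.
  rewrite (_ : (fun x => _) = fun x : 'rV[R]_d => x 0 i); first exact: smooth_on_coord.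
  by apply/funext => x; rewrite row_mxEl.
have -> : j = rshift d i by exact: val_inj.
rewrite (_ : (fun x => _) = fun x : 'rV[R]_d => 0); first exact: smooth_on_cst.
by apply/funext => x; rewrite row_mxEr mxE.
Qed.

Lemma curve_derive_interior n (K : set 'rV[R]_n) f c x : interior K x ->
  smooth_on (interior K) f -> curve_derive c f x = 'D_(c - x) f x.
Proof.
move=> Kx sf; set v := c - x; pose U := interior K.
have oU : open U := @open_interior _ K.
have cs : continuous (square_curve c x).
  move=> s; apply: cvgD; first exact: cvg_cst.
  by apply: cvgZr_tmp; apply: exprn_continuous.
have dsq (s : R) : is_derive s (1 : R) (fun s : R => s ^+ 2) (2 * s).
  apply: DeriveDef; first exact: exprn_derivable.
  by rewrite exp_derive expr1 /GRing.scale /= mulr1.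
have dline (h : 'rV[R]_n -> R) (s : R) : smooth_on U h -> U (square_curve c x s) ->
    is_derive s (1 : R) (fun s => h (square_curve c x s))
      (2 * s * 'D_v h (square_curve c x s)).
  move=> sh Us; have dh := is_derive_line (v := v) (smooth_on_differentiable sh Us).
  have := @is_derive1_comp _ (fun r => h (x + r *: v)) (fun s : R => s ^+ 2) s _ _ dh (dsq s).
  by rewrite mulrC.
have Us0 : U (square_curve c x 0) by rewrite /square_curve expr0n scale0r addr0.
have nU : \forall s \near (0 : R), U (square_curve c x s).
  by apply: (cs 0); exact: open_nbhs_nbhs.
have n1 : \forall s \near (0 : R),
    'D_(1 : R) (fun s => f (square_curve c x s)) s =
    2 * s * 'D_v f (square_curve c x s).
  by apply: filterS nU => s Us; have [_ ->] := dline f s sf Us.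
rewrite /curve_derive (near_eq_derive _ n1).
have dk := dline _ _ (smooth_on_derive v sf) Us0.
have d2 : is_derive (0 : R) (1 : R) (fun s : R => 2 * s) 2.
  by apply: is_derive_eq (is_deriveZ 2 (is_derive_id (0 : R) (1 : R))) _; rewrite [LHS]mulr1.
have [_ ->] := is_deriveM d2 dk.
rewrite mulr0 scale0r add0r /square_curve expr0n scale0r addr0 /GRing.scale /=.
by rewrite [X in _ * X]mulrC mulKf.
Qed.

(** The derivatives in the directions b + (r/2) e_i - x and b - x differ by r/2
    times the i-th partial derivative. *)
Lemma plot_smooth_partial n (K : set 'rV[R]_n) f b r i : segment_convex K ->
  0 < r -> (forall x, `|x - b| < r -> K x) -> plot_smooth K f ->
  exists2 g, plot_smooth K g &
    forall x, interior K x -> 'D_(delta_mx 0 i) f x = g x.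
Proof.
move=> sK r0 bK Kf; pose e : 'rV[R]_n := delta_mx 0 i.
pose b' := b + (r / 2) *: e.
have Kb : K b by apply: bK; rewrite subrr normr0.
have Kb' : K b'.
  apply: bK; rewrite /b' addrAC subrr add0r normrZ gtr0_norm ?divr_gt0//.
  rewrite (@le_lt_trans _ _ (r / 2 * 1))//; last by rewrite mulr1; lra.
  rewrite ler_pM2l ?divr_gt0//; apply: norm_le_coord => // j.
  by rewrite mxE eqxx /=; case: (j == i); rewrite ?normr0 ?normr1.
exists (fun x => (2 / r) * (curve_derive b' f x - curve_derive b f x)).
  by apply: plot_smooth_comb; exact: plot_smooth_curve_derive.
move=> x Kx; have sf := plot_smooth_interior Kf.
rewrite !(curve_derive_interior _ Kx sf).
have dfx := smooth_on_differentiable sf Kx.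
rewrite !deriveE// -linearB.
have -> : b' - x - (b - x) = (r / 2) *: e.
  by rewrite /b'; apply/rowP => j; rewrite !mxE; ring.
by rewrite linearZ /= mulrA (_ : 2 / r * (r / 2) = 1) ?mul1r//; field; rewrite gt_eqF.
Qed.

Lemma plot_smooth_dbound n (K : set 'rV[R]_n) b r f k : compact K -> segment_convex K ->
  0 < r -> (forall x, `|x - b| < r -> K x) -> plot_smooth K f ->
  exists M, dbound k (interior K) f M.
Proof.
move=> cK sK r0 bK; elim: k f => [|k IH] f Kf; have [M0 fM0] := plot_smooth_bounded cK sK Kf.
  by exists M0; split=> // x /interior_subset; exact: fM0.
have [M fM] : exists M, forall i, dbound k (interior K) ('D_(delta_mx 0 i) f) M.
  have /choice[M fM] : forall i, exists M, dbound k (interior K) ('D_(delta_mx 0 i) f) M.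
    move=> i; have [g Kg fg] := plot_smooth_partial i sK r0 bK Kf.
    have [M gM] := IH g Kg; exists M.
    by apply: dbound_eq gM => //; exact: open_interior.
  exists (\sum_i `|M i|) => i; apply: dbound_weaken (fM i).
  by rewrite (bigD1 i)//= (le_trans (ler_norm _))// lerDl sumr_ge0.
exists (`|M0| + `|M|); split.
  move=> x /interior_subset /fM0 /le_trans; apply.
  by rewrite (le_trans (ler_norm _))// lerDl.
by move=> i; apply: dbound_weaken (fM i); rewrite (le_trans (ler_norm _))// lerDr.
Qed.

Theorem plot_smooth_extends n (K : set 'rV[R]_n) b r f : compact K -> segment_convex K ->
  0 < r -> (forall x, `|x - b| < r -> K x) -> plot_smooth K f ->
  exists2 F, smooth_on setT F & forall x, K x -> F x = f x.
Proof.
move=> cK sK r0 bK Kf.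
have [M [_ KM]] := compact_bounded cK.
have KL x : K x -> `|x| <= M + 1 by apply: KM; rewrite ltrDl.
have [F sF Ff] := extension_bounded_derivs sK r0 bK KL (plot_smooth_interior Kf)
  (fun k => plot_smooth_dbound k cK sK r0 bK Kf).
exists F => // x Kx.
(* For s != 0 this curve lies in the interior, where [F] and [f] agree. *)
pose q (s : 'rV[R]_1) := square_curve b x (s 0 0).
pose V := [set s : 'rV[R]_1 | `|s 0 0| < 1].
have Kb : K b by apply: bK; rewrite subrr normr0.
have oV : open V.
  apply: (@open_comp _ _ (fun z : 'rV[R]_1 => `|z 0 0|) [set r : R | r < 1]).
    move=> z _; apply: continuous_comp; first exact: coord_continuous.
    exact: norm_continuous.
  exact: open_lt.
have sq i : smooth_on V (fun s => q s 0 i).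
  rewrite (_ : (fun s => q s 0 i) = fun s => x 0 i + (s 0 0 * s 0 0) * (b 0 i - x 0 i)).
    apply: smooth_onD => //; first exact: smooth_on_cst.
    apply: smooth_onM => //; last exact: smooth_on_cst.
    by apply: smooth_onM => //; exact: smooth_on_coord.
  by apply/funext => s; rewrite !mxE expr2.
have sq1 (s : 'rV[R]_1) : V s -> 0 <= s 0 0 ^+ 2 <= 1.
  move=> Vs; rewrite sqr_ge0/= -real_normK ?num_real// expr_le1// ltW//.
have V0 : V 0 by rewrite /V /= mxE normr0.
have cf : {for 0, continuous (fun s => f (q s))}.
  by apply: (smooth_on_continuous _ V0); apply: Kf => // s Vs; apply: sK => //; exact: sq1.
have cF : {for 0, continuous (fun s => F (q s))}.
  by apply: (smooth_on_continuous _ V0); apply: (smooth_on_comp_row (U' := setT)).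
have q0 : q 0 = x by rewrite /q /square_curve mxE expr0n scale0r addr0.
have := cvg_half_powers cF; have := cvg_half_powers cf; rewrite q0 => cvf cvF.
suff E j : F (q (const_mx (2^-1 ^+ j))) = f (q (const_mx (2^-1 ^+ j))).
  move: cvF; rewrite (funext E) => cvF; exact: (cvg_unique _ cvF cvf).
apply: Ff.
have h0 : 0 < (2^-1 ^+ j) ^+ 2 :> R by rewrite !exprn_gt0.
have h1 : (2^-1 ^+ j) ^+ 2 <= 1 :> R.
  by rewrite !exprn_ile1// ?exprn_ge0// ?invr_ge0// invf_le1// ler1n.
apply: (interior_dil sK bK Kx (q := 1 - (2^-1 ^+ j) ^+ 2)).
  by rewrite subr_ge0 h1/= gtrBl.
rewrite /q /square_curve mxE (_ : _ - _ = 0).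
  by rewrite normr0 opprB addrCA subrr addr0 mulr_gt0.
by apply/rowP => i; rewrite !mxE; ring.
Qed.

End one_sided_derivative.

(** * Reduction to convex bodies *)

Section affine_hull.
Context {R : realType}.

Definition in_multiple m (K : set 'rV[R]_m) (t : R) (y : 'rV[R]_m) : Prop :=
  exists2 k, K k & y = t *: k.

(** Keeping the total factor separate builds finite convex combinations by
    induction, without normalising the partial sums. *)
Lemma in_multipleD m (K : set 'rV[R]_m) t s u v : segment_convex K ->
  0 <= t -> 0 <= s -> in_multiple K t u -> in_multiple K s v ->
  in_multiple K (t + s) (u + v).
Proof.
move=> sK t0 s0 [k Kk ->] [l Kl ->].
have [ts|ts] := eqVneq (t + s) 0.
  have t00 : t = 0 by lra.
  have s00 : s = 0 by lra.
  by exists k => //; rewrite t00 s00 !scale0r !addr0 scale0r.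
have ts0 : 0 < t + s by rewrite lt_neqAle eq_sym ts addr_ge0.
exists (k + (s / (t + s)) *: (l - k)).
  apply: sK => //; rewrite divr_ge0 ?(ltW ts0)//= ler_pdivrMr// mul1r lerDr//.
by apply/rowP => i; rewrite !mxE; field.
Qed.

Lemma simplex_sub m (K : set 'rV[R]_m) : segment_convex K -> K 0 ->
  (forall i, K (delta_mx 0 i)) ->
  forall y : 'rV[R]_m, (forall i, 0 <= y 0 i) -> \sum_i y 0 i <= 1 -> K y.
Proof.
move=> sK K0 Ke y y0 y1.
have [k Kk ->] : in_multiple K (\sum_i y 0 i) y.
  rewrite [X in in_multiple _ _ X]row_sum_delta.
  suff [//] : in_multiple K (\sum_i y 0 i) (\sum_i y 0 i *: delta_mx 0 i) /\ 0 <= \sum_i y 0 i.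
  elim/big_ind2 : _ => [|t u s v [Kt t0] [Ks s0]|i _].
  - by split=> //; exists 0 => //; rewrite scaler0.
  - by split; [exact: in_multipleD|exact: addr_ge0].
  - by split=> //; exists (delta_mx 0 i).
have := sK 0 k (\sum_i y 0 i) K0 Kk; rewrite add0r subr0; apply.
by rewrite y1 andbT sumr_ge0.
Qed.

(** The ball about the barycentre (1/(m+1), ..., 1/(m+1)) of radius 1/(m+1)^2
    lies in the standard simplex. *)
Lemma simplex_ball m (K : set 'rV[R]_m) : segment_convex K -> K 0 ->
  (forall i, K (delta_mx 0 i)) ->
  exists b r, 0 < r /\ forall x : 'rV[R]_m, `|x - b| < r -> K x.
Proof.
move=> sK K0 Ke.
have [w [w0 w1 mw]] : exists w : R, [/\ 0 < w, w <= 1 & m%:R * w = 1 - w].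
  exists m.+1%:R^-1; rewrite invr_gt0 ltr0n invf_le1 ?ltr0n// ler1n; split=> //.
  by rewrite -natr1; field; rewrite natr1 pnatr_eq0.
have ww : w ^+ 2 <= w by rewrite expr2 ler_piMl// ltW.
exists (const_mx w), (w ^+ 2); split; first by rewrite exprn_gt0.
move=> x xb; apply: simplex_sub => // [i|].
  have := le_lt_trans (norm_coord_le _ i) xb; rewrite !mxE ltr_norml => /andP[h _].
  lra.
have xi i : x 0 i <= w + w ^+ 2.
  have := le_lt_trans (norm_coord_le _ i) xb; rewrite !mxE ltr_norml => /andP[_ h].
  lra.
rewrite (le_trans (ler_sum _ (fun i _ => xi i)))// sumr_const card_ord -mulr_natl.
have -> : m%:R * (w + w ^+ 2) = m%:R * w + w * (m%:R * w) :> R by ring.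
by rewrite mw; nra.
Qed.

Lemma smooth_on_affine d n (U : set 'rV[R]_d) (X : 'M[R]_(d, n)) (u : 'rV[R]_d)
   (a : 'rV[R]_n) i : open U ->
  smooth_on U (fun x : 'rV[R]_d => (a + (x - u) *m X) 0 i).
Proof.
move=> oU.
rewrite (_ : (fun x => _) = fun x : 'rV[R]_d => a 0 i + \sum_j (x 0 j - u 0 j) * X j i).
  apply: smooth_onD => //; first exact: smooth_on_cst.
  apply: smooth_on_sum => // j _; apply: smooth_onM => //; last exact: smooth_on_cst.
  by apply: smooth_onB => //; [exact: smooth_on_coord|exact: smooth_on_cst].
apply/funext => x; rewrite !mxE; congr (_ + _); apply: eq_bigr => j _.
by rewrite !mxE.
Qed.

(** If a point of [K] were outside the affine span of a maximal family, it could
    be added to the family. *)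
Lemma affine_frame n (K : set 'rV[R]_n) a : K a ->
  exists m (X : 'M[R]_(m, n)), [/\ row_free X, forall i, K (a + row i X)
    & forall x, K x -> (x - a <= X)%MS].
Proof.
move=> Ka.
pose P m := `[< exists2 X : 'M[R]_(m, n), row_free X & forall i, K (a + row i X) >].
have P0 : exists m, P m.
  exists 0%N; apply/asboolP; exists 0; last by case.
  by rewrite /row_free mxrank0.
have Pn m : P m -> (m <= n)%N.
  by move=> /asboolP[X /eqP fX _]; have := rank_leq_col X; rewrite fX.
case: (ex_maxnP P0 Pn) => m /asboolP[X fX KX] mmax.
exists m, X; split=> // x Kx; apply: contrapT => /negP xX.
suff : P (1 + m)%N by move/mmax; rewrite add1n ltnn.
apply/asboolP; exists (col_mx (x - a) X); last first.
  move=> i; case: (splitP i) => j ij.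
    have -> : i = lshift m j by exact: val_inj.
    by rewrite rowKu row_id addrC subrK.
  have -> : i = rshift 1 j by exact: val_inj.
  by rewrite rowKd.
have lt : (X < (x - a)%R + X)%MS by rewrite ltmxE addsmxSr /= addsmx_sub (negbTE xX).
rewrite /row_free eqn_leq rank_leq_row /= -addsmxE.
by have := rank_ltmx lt; rewrite (eqP fX).
Qed.

Theorem compact_plot_extends n (K : set 'rV[R]_n) f : compact K ->
  segment_convex K -> plot_smooth K f ->
  exists2 F, smooth_on setT F & forall x, K x -> F x = f x.
Proof.
move=> cK sK Kf.
have [[a Ka]|K0] := pselect (exists a, K a); last first.
  by exists (fun=> 0); [exact: smooth_on_cst|move=> x Kx; case: K0; exists x].
have [m [X [fX KX XK]]] := affine_frame Ka.
pose A (y : 'rV[R]_m) := a + (y - 0) *m X.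
pose B (x : 'rV[R]_n) := 0 + (x - a) *m pinvmx X.
have AE y : A y = a + y *m X by rewrite /A subr0.
have BA y : B (A y) = y by rewrite AE /B add0r addrAC subrr add0r mulmxKp.
have AB x : K x -> A (B x) = x.
  by move=> Kx; rewrite AE /B add0r mulmxKpV ?XK// addrC subrK.
pose K' := A @^-1` K.
have cB : continuous B.
  move=> x; have sB i := smooth_on_continuous (@smooth_on_affine n m setT (pinvmx X) a 0 i openT) (x := x) I.
  rewrite (_ : B = fun x => \row_i B x 0 i); last first.
    by apply/funext => z; apply/rowP => i; rewrite mxE.
  exact: continuous_row.
have cK' : compact K'.
  have -> : K' = B @` K.
    apply/seteqP; split=> [y Ky|_ [x Kx <-]]; last by rewrite /K' /= AB.
    by exists (A y) => //; exact: BA.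
  apply: continuous_compact => //; exact: continuous_subspaceT.
have sK' : segment_convex K'.
  move=> y z t Ky Kz t01; rewrite /K' /=.
  have -> : A (y + t *: (z - y)) = A y + t *: (A z - A y).
    rewrite !AE mulmxDl -scalemxAl mulmxBl -addrA; congr (_ + (_ + _ *: _)).
    by rewrite opprD addrACA subrr add0r.
  exact: sK.
have [b [r [r0 bK]]] : exists b r, 0 < r /\ forall x : 'rV[R]_m, `|x - b| < r -> K' x.
  apply: simplex_ball => // [|i]; first by rewrite /K' /= AE mul0mx addr0.
  by rewrite /K' /= AE -rowE.
have K'f : plot_smooth K' (fun y => f (A y)).
  move=> d U p oU sp pK'; apply: Kf => // i.
  apply: (smooth_on_comp_row (U' := setT) (f := fun y => A y 0 i)) => //.
  by apply: smooth_on_affine; exact: openT.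
have [F' sF' F'f] := plot_smooth_extends cK' sK' r0 bK K'f.
exists (fun x => F' (B x)).
  apply: (smooth_on_comp_row (U' := setT)) => //; first exact: openT.
  by move=> i; apply: smooth_on_affine; exact: openT.
by move=> x Kx; rewrite F'f ?AB// /K' /= AB.
Qed.

Theorem closed_plot_extends n (K : set 'rV[R]_n) f a : closed K ->
  segment_convex K -> plot_smooth K f ->
  exists2 F, smooth_on setT F & forall x, K x -> `|x - a| <= 1 -> F x = f x.
Proof.
move=> cK sK Kf; pose K1 := K `&` closed_ball a 1.
have K1E x : K1 x <-> K x /\ `|x - a| <= 1.
  by rewrite /K1 closed_ballE// /closed_ball_ /= distrC.
have [|||F sF Ff] := @compact_plot_extends n K1 f.
- apply: bounded_closed_compact.
    exists (`|a| + 1); split; first exact: num_real.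
    move=> M aM x /K1E[_ xa] /=; rewrite -(subrK a x).
    rewrite (le_trans (ler_normD _ _))//; apply: le_trans (ltW aM).
    by rewrite addrC lerD2l.
  by apply: closedI => //; exact: closed_ball_closed.
- move=> x y t /K1E[Kx xa] /K1E[Ky ya] t01; apply/K1E; split; first exact: sK.
  have -> : x + t *: (y - x) - a = (1 - t) *: (x - a) + t *: (y - a).
    by apply/rowP => i; rewrite !mxE; ring.
  have [t0 t1] := andP t01.
  rewrite (le_trans (ler_normD _ _))// !normrZ !ger0_norm ?subr_ge0//.
  have : (1 - t) * `|x - a| <= (1 - t) * 1 by rewrite ler_wpM2l ?subr_ge0.
  have : t * `|y - a| <= t * 1 by rewrite ler_wpM2l.
  lra.
- move=> d U p oU sp pK; apply: Kf => // x Ux.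
  by have /K1E[] := pK x Ux.
- by exists F => // x Kx xa; apply: Ff; apply/K1E.
Qed.

End affine_hull.

(** * Sikorski structures and plots *)

Section sikorski_plots.
Context {R : realType}.

(** The squared distance is a smooth function, so its sublevel sets are open for
    the initial topology. *)
Lemma sikorski_nbhs_ball n (a : 'rV[R]_n) : exists2 W : set 'rV[R]_n,
  nbhs (a : sikorski_topology (euclidean_sikorski n : set ('rV[R]_n -> R))) W &
  forall x, W x -> `|x - a| <= 1.
Proof.
pose N (x : 'rV[R]_n) := \sum_i (x 0 i - a 0 i) * (x 0 i - a 0 i).
have oT : open [set: 'rV[R]_n] := openT.
have sN : smooth_on setT N.
  apply: smooth_on_sum => // i _.
  by apply: smooth_onM => //; apply: smooth_onB => //;
    [exact: smooth_on_coord|exact: smooth_on_cst|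
     exact: smooth_on_coord|exact: smooth_on_cst].
exists [set x | N x < 1].
  apply: (@sikorski_continuous _ _ (euclidean_sikorski n : set ('rV[R]_n -> R)) N sN a
    [set r | r < 1]).
  apply: open_nbhs_nbhs; split; first exact: open_lt.
  by rewrite /= /N big1// => i _; rewrite subrr mul0r.
move=> x; rewrite /= /N => xN; apply: norm_le_coord => // i.
rewrite !mxE -(@expr_le1 _ 2)// real_normK ?num_real// expr2 (le_trans _ (ltW xN))//.
by rewrite (bigD1 i)//= lerDl sumr_ge0// => j _; rewrite -expr2 sqr_ge0.
Qed.

Lemma euclidean_nbhs n (a : 'rV[R]_n) (W : set 'rV[R]_n) :
  nbhs (a : sikorski_topology (euclidean_sikorski n : set ('rV[R]_n -> R))) W ->
  nbhs a W.
Proof.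
apply: (@continuous_sikorski _ _ _ (euclidean_sikorski n) id) => g sg y.
exact: (sg 0).
Qed.

(** A smooth map into [K] is a plot for the subspace structure, because functions
    of that structure are restrictions of smooth functions near each point of
    the image. *)
Lemma plot_smooth_Phi_Pi n (K : set 'rV[R]_n) (f : K -> R) :
  sikorski_fun (Phi_sikorski (Pi_diffeology
    (subspace_sikorski (euclidean_sikorski n) K))) f ->
  plot_smooth K ('valL_0 f).
Proof.
move=> Ff d U p oU sp pK; pose O := Opens oU.
pose p' (u : O) : K := SigSub (mem_set (pK _ (set_valE_in u))).
have p'E u : set_val (p' u) = p (set_val u) by [].
suff Pp : Pi_diffeology (subspace_sikorski (euclidean_sikorski n) K) d O p'.
  apply: (smooth_on_eq oU _ (Ff d O p' Pp)) => x Ux.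
  have [u xu] := @set_val_ex _ (O : set _) x Ux.
  by rewrite xu -p'E !valL_val.
move=> g Fg; apply: smooth_fun_near => u.
have [W [G [aW sG Gg]]] := Fg (p' u).
have cp : {for (set_val u), continuous p}.
  rewrite (_ : p = fun x => \row_i p x 0 i); last first.
    by apply/funext => x; apply/rowP => i; rewrite mxE.
  by apply: continuous_row => i; apply: (smooth_on_continuous (sp i)); exact: (set_valE_in u).
have : nbhs (set_val u) (p @^-1` W) by apply: cp; exact: (euclidean_nbhs aW).
rewrite nbhsE => -[V [oV Vu] VW].
exists V, (fun x => G (p x)); split=> //.
- by move=> y Vy; rewrite -p'E Gg//; exact: VW.
- apply: (smooth_on_comp_row (U' := setT)) => //; first exact: openI.
  by move=> i; apply: smooth_onS (sp i) => x [].
Qed.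

End sikorski_plots.

Lemma convex_set_segment (R : realType) n (K : set 'rV[R]_n) :
  @convex_set R 'rV[R]_n K -> segment_convex K.
Proof.
move=> cK x y t Kx Ky /andP[t0 t1].
have := cK y x (Itv01 t0 t1) (mem_set Ky) (mem_set Kx); rewrite inE.
have -> : x + t *: (y - x) = t *: y + (1 - t) *: x.
  by apply/rowP => i; rewrite !mxE; ring.
exact.
Qed.

Theorem theorem4p1 (R : realType) (n : nat) (K : set 'rV[R]_n) :
  closed K -> @convex_set R 'rV[R]_n K ->
  reflexive_sikorski (subspace_sikorski (euclidean_sikorski n) K).
Proof.
move=> cK /convex_set_segment sK; apply: eq_sikorski; apply/seteqP; split=> f Ff.
  move=> a; have [W aW W1] := sikorski_nbhs_ball (set_val a).
  have [G sG Gf] := closed_plot_extends (set_val a) cK sK (plot_smooth_Phi_Pi Ff).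
  exists W, G; split=> // y Wy.
  rewrite Gf ?valL_val//; [exact: set_valE_in|exact: W1].
by move=> d U p Pp; exact: Pp.
Qed.
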